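(* Let $d\ge2$ and let $P^{0,d}$ and $Q^{0,d}$ be the laws of the bridges (from and to the origin) of the random walks on $\{0,1\}^d$ with jump rates $\alpha_i$, respectively $\beta_i$, in the direction $e_i$, for $i=1,\dots,d$. Then $$d_{W,1}(P^{0,d},Q^{0,d})\le\frac92\sum_{i=1}^d|\alpha_i^2-\beta_i^2|,$$ where the Wasserstein distance is taken on $(\mathscr{U}^d,d_{\mathscr{U}^d})$ with the metric $d_{\mathscr{U}^d}(U,V):=\sum_{i=1}^d d(U_i,V_i)$, $U,V\in\mathscr{U}^d$.
   Context: For $\alpha_1,\dots,\alpha_d\ge0$ the random walk on $\{0,1\}^d$ with jump rates $\alpha_i$ in direction $e_i$ is the continuous-time Markov chain, with time horizon $[0,1]$, that flips its $i$-th coordinate at rate $\alpha_i$, independently for $i=1,\dots,d$. Its bridge is its law conditioned to be at the origin at times $0$ and $1$. $\mathscr{U}$ is the set of all finite subsets of $(0,1)$ of even cardinality (including $\emptyset$). Càdlàg paths in $\{0,1\}$ from $0$ to $0$ on $[0,1]$ are in bijection with $\mathscr{U}$ via their set of jump times; $\mathscr{U}$ carries the transported $\sigma$-algebra and $\mathscr{U}^d$ the product $\sigma$-algebra. The bridge laws on $\{0,1\}^d$ are identified with laws on $\mathscr{U}^d$ by recording, for each $i$, the set of jump times of the $i$-th coordinate. For $r\ne s$ in $(0,1)$: $\Psi_{r,s}(U)=U\cup\{r,s\}$ if $\{r,s\}\cap U=\emptyset$, $U\setminus\{r,s\}$ if $\{r,s\}\subset U$, and $U$ otherwise. The metric $d$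 on $\mathscr{U}$ is the graph distance with $U\ne V$ neighbours iff $U=\Psi_{r,s}V$ for some $r<s$. On $\mathscr{U}^d$, $d_{W,1}(\mu,\nu)=\sup|\int f\,d\mu-\int f\,d\nu|$ over measurable ($\mu$- and $\nu$-integrable) $f:\mathscr{U}^d\to\mathbb{R}$ which are $1$-Lipschitz for $d_{\mathscr{U}^d}$. *)

(* Defs.v *)
From HB Require Import structures.
From mathcomp Require Import all_boot all_order all_algebra finmap.
From mathcomp Require Import all_classical all_reals all_analysis.

Set Implicit Arguments.
Unset Strict Implicit.
Unset Printing Implicit Defensive.

Import Order.TTheory GRing.Theory Num.Theory.
Import numFieldNormedType.Exports.

Local Open Scope classical_set_scope.
Local Open Scope ring_scope.

Definition even_in_unit_interval (R : realType) (U : {fset R}) : bool :=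
  all (fun t => 0 < t < 1) (enum_fset U) && ~~ odd #|` U|%fset.

Record even_fset (R : realType) : Type := EvenFset {
  even_fset_val :> {fset R};
  even_fset_valP : even_in_unit_interval even_fset_val
}.

Lemma even_in_unit_interval0 (R : realType) :
  @even_in_unit_interval R fset0%fset.
Proof. by rewrite /even_in_unit_interval cardfs0 andbT; apply/allP. Qed.

HB.instance Definition _ (R : realType) :=
  [isSub of even_fset R for @even_fset_val R].
HB.instance Definition _ (R : realType) := [Choice of even_fset R by <:].
HB.instance Definition _ (R : realType) :=
  isPointed.Build (even_fset R) (EvenFset (even_in_unit_interval0 R)).

(* The value at time t of the cadlag path from 0 whose jump times are U. *)
Definition path_of (R : realType) (U : {fset R}) (t : R) : bool :=
  odd #|` [fset s in U | s <= t]|%fset.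

(* The sigma-algebra on cadlag paths is the one generated by the evaluation
   maps; these are its generators seen through the bijection [path_of]. *)
Definition evaluation_sets (R : realType) : set (set (even_fset R)) :=
  [set A | exists t : R, 0 <= t <= 1 /\ A = [set U : even_fset R | path_of U t]].
Arguments evaluation_sets R : clear implicits.

Definition even_fset_display (R : realType) : measure_display :=
  sigma_display (evaluation_sets R).

HB.instance Definition _ (R : realType) :=
  @isMeasurable.Build (even_fset_display R) (even_fset R)
    <<s evaluation_sets R>>
    (@sigma_algebra0 _ setT (evaluation_sets R))
    (@sigma_algebraC _ (evaluation_sets R))
    (@sigma_algebra_bigcup _ setT (evaluation_sets R)).

Definition Psi (R : realType) (r s : R) (U : {fset R}) : {fset R} :=
  (if (r \notin U) && (s \notin U) then U `|` [fset r; s]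
   else if (r \in U) && (s \in U) then U `\` [fset r; s]
   else U)%fset.

Definition neighbours (R : realType) (U V : even_fset R) : Prop :=
  U <> V /\ exists r s : R,
    [/\ 0 < r, r < s, s < 1 & even_fset_val U = Psi r s V].

(* Graph distance: the least number of edges of a walk from U to V (+oo if
   there were none). *)
Definition graph_dist (R : realType) (U V : even_fset R) : \bar R :=
  ereal_inf [set (size w)%:R%:E | w in
    [set w : seq (even_fset R) |
      path (fun A B => `[< neighbours A B >]) U w /\ last U w = V]].

Definition prod_dist (R : realType) (d : nat)
    (U V : d.-tuple (even_fset R)) : \bar R :=
  (\sum_(i < d) graph_dist (tnth U i) (tnth V i))%E.

Definition lipschitz1 (R : realType) (d : nat)
    (f : d.-tuple (even_fset R) -> R) : Prop :=
  forall U V, (`|f U - f V|%:E <= prod_dist U V)%E.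

Definition wasserstein1 (R : realType) (d : nat)
    (mu nu : probability (d.-tuple (even_fset R)) R) : \bar R :=
  ereal_sup [set `| \int[mu]_U (f U)%:E - \int[nu]_U (f U)%:E |%E | f in
    [set f : d.-tuple (even_fset R) -> R |
      [/\ measurable_fun setT f,
          mu.-integrable setT (EFin \o f),
          nu.-integrable setT (EFin \o f)
        & lipschitz1 f]]].

Notation cube d := {ffun 'I_d -> bool}.

Definition origin (d : nat) : cube d := [ffun=> false].

Definition flip (d : nat) (i : 'I_d) (x : cube d) : cube d :=
  [ffun j => if j == i then ~~ x j else x j].

(* The rate matrix of the chain jumping from x to [flip i x] at rate a i. *)
Definition flip_generator (R : realType) (d : nat) (a : 'I_d -> R)
    (x y : cube d) : R :=
  if y == x then - \sum_(i < d) a i else \sum_(i < d | y == flip i x) a i.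

(* p is the transition function of the rate matrix q: the solution of
   Kolmogorov's forward equation p' = p q started from the identity. *)
Definition transition_function (R : realType) (S : finType)
    (q : S -> S -> R) (p : R -> S -> S -> R) : Prop :=
  [/\ forall x y, p 0 x y = (x == y)%:R,
      forall x y, p h x y @[h --> 0^'+] --> p 0 x y
    & forall (t : R) x y, 0 < t ->
        is_derive t 1 (fun u : R => p u x y) (\sum_z p t x z * q z y)].

Definition markov_chain (R : realType) (S : finType) (q : S -> S -> R)
    (disp : measure_display) (Omega : measurableType disp)
    (P : probability Omega R) (X : R -> Omega -> S) : Prop :=
  (forall t x, 0 <= t <= 1 -> measurable [set w | X t w = x]) /\
  exists2 p, transition_function q p &
    forall (n : nat) (t : nat -> R) (x : nat -> S),
      0 <= t 0%N -> (forall k, (k <= n)%N -> t k <= t k.+1) -> t n.+1 <= 1 ->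
      (P [set w | forall k, (k <= n.+1)%N -> X (t k) w = x k] =
       P [set w | forall k, (k <= n)%N -> X (t k) w = x k] *
         (p (t n.+1 - t n) (x n) (x n.+1))%:E)%E.

Definition cadlag (R : realType) (x : R -> bool) : Prop :=
  (forall t : R, 0 <= t < 1 -> x u @[u --> t^'+] --> x t) /\
  (forall t : R, 0 < t <= 1 -> cvg (x u @[u --> t^'-])).

Definition jump_times (R : realType) (x : R -> bool) : set R :=
  [set t | 0 < t <= 1 /\ ~ (x u @[u --> t^'-] --> x t)].

Definition random_walk (R : realType) (d : nat) (a : 'I_d -> R)
    (disp : measure_display) (Omega : measurableType disp)
    (P : probability Omega R) (X : R -> Omega -> cube d) : Prop :=
  markov_chain (flip_generator a) P X /\
  forall w (i : 'I_d), cadlag (fun t => X t w i).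

(* mu is the law, on tuples of jump sets, of a random walk with rates a
   conditioned to be at the origin at times 0 and 1.  The outcomes with a jump
   at time 1, which form a null event, correspond to no tuple. *)
Definition bridge_law (R : realType) (d : nat) (a : 'I_d -> R)
    (mu : probability (d.-tuple (even_fset R)) R) : Prop :=
  exists (disp : measure_display) (Omega : measurableType disp)
         (P : probability Omega R) (X : R -> Omega -> cube d),
    let E := [set w | X 0 w = origin d /\ X 1 w = origin d] in
    [/\ random_walk a P X,
        (0 < P E)%E
      & forall A, measurable A ->
          let B := [set w | exists2 U, A U &
            forall i, jump_times (fun t => X t w i) =
                      [set t | t \in even_fset_val (tnth U i)]] in
          mu A = (fine (P (E `&` B)) / fine (P E))%:E].

(* Main.v *)
Require Import Defs.
From HB Require Import structures.
From mathcomp Require Import all_boot all_order all_algebra finmap.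
From mathcomp Require Import all_classical all_reals all_analysis.
From mathcomp Require Import measurable_realfun.
From mathcomp Require Import ring lra.

Set Implicit Arguments.
Unset Strict Implicit.
Unset Printing Implicit Defensive.

Import Order.TTheory GRing.Theory Num.Theory.
Import numFieldNormedType.Exports.

Local Open Scope classical_set_scope.
Local Open Scope ring_scope.

(** A path of the walk on {0,1} pinned at 0 at both ends is the same thing as the
    finite even set of its jump times.  For the bridge with rate a this set
    consists of 2K independent uniform points of the unit interval, where K = k
    has probability w_k(a) = a^(2k) / (2k)! / cosh a: a Poisson process
    conditioned to have an even number of points.  Hence bridges with different
    rates have the same conditional laws given K.  Adding one more pair of
    uniform points moves a path by at most 2 in the graph distance, so that two
    one-dimensional bridges are at distance at most
    2 sum_k k |w_k(a) - w_k(b)|, and elementary moment estimates for the weights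
    bound this by (17/8) |a^2 - b^2| ([sum_weightB_le], [bridge1_wasserstein]).
    The coordinates of the bridge on the cube are independent, and replacing the
    rates one coordinate at a time adds up the one-dimensional bounds
    ([bridge_product_wasserstein]).  The constant 17/8 is below 9/2.

    The rest of the proof identifies the law of jump sets of a conditioned Markov
    chain with this explicit model ([bridge_law_unique]).  Laws are compared
    through products of the signs (-1)^(position at time t).  In the model, adding
    two uniform points multiplies such a product by an independent factor, so
    products of signs are eigenfunctions of the operation of adding a pair, with
    eigenvalue c^2 where c is the integral over the unit interval of a step
    function with values 1 and -1; averaging over K gives cosh (a c) / cosh a
    ([bridge1_chi]).  For the chain, the characters of the cube are eigenvectors of
    the generator ([flip_generator_char]), the forward equation then says that the
    semigroup acts on them by exponentials ([transition_char]), and peeling off the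
    observation times from the last to the first produces the same integral c
    ([walk_moment]).  The indicator of the final position being the origin is an
    average of characters, and this average turns the exponentials into hyperbolic
    cosines ([bridge_sign_moment]).  Indicators of finite-dimensional events are
    linear combinations of products of signs ([expansionE]), so the two laws agree
    on a generating pi-system.  Finally, a right-continuous path with left limits
    in {0,1} has finitely many jumps and is recovered from the parity of their
    number ([jump_count]), which is what allows to read events on jump sets as
    events of the chain. *)

(** * Toggling points of a jump set *)

Section toggling.
Context (R : realType).
Implicit Types (u v t : R) (V : {fset R}).

Definition toggle1 u V : {fset R} := (if u \in V then V `\ u else u |` V)%fset.

Lemma in_toggle1 u V x : (x \in toggle1 u V) = (x \in V) (+) (x == u).
Proof.
rewrite /toggle1; case: ifP => uV; rewrite !inE.
  by have [->|] := eqVneq x u; rewrite ?uV //= addbF.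
by have [->|] := eqVneq x u; rewrite ?uV //= addbF.
Qed.

Lemma toggle1C u v V : toggle1 u (toggle1 v V) = toggle1 v (toggle1 u V).
Proof. by apply/fsetP => x; rewrite !in_toggle1 addbAC. Qed.

Lemma toggle1K u : involutive (toggle1 u).
Proof. by move=> V; apply/fsetP => x; rewrite !in_toggle1 addbK. Qed.

Lemma odd_toggle1 u V : odd #|` toggle1 u V|%fset = ~~ odd #|` V|%fset.
Proof.
rewrite /toggle1; case: ifP => uV.
  by rewrite (cardfsD1 u V) uV /= negbK.
by rewrite cardfsU1 uV.
Qed.

Lemma path_of_toggle1 u V t : path_of (toggle1 u V) t = path_of V t (+) (u <= t).
Proof.
rewrite /path_of; case: (boolP (u <= t)) => ut.
  rewrite addbT -(odd_toggle1 u); congr (odd #|` _|%fset).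
  apply/fsetP => x; rewrite in_toggle1 !inE in_toggle1.
  by have [->|] := eqVneq x u; rewrite ?ut ?andbT ?addbF.
rewrite addbF; congr (odd #|` _|%fset).
apply/fsetP => x; rewrite !inE in_toggle1.
by have [->|] := eqVneq x u; rewrite ?(negbTE ut) ?andbF ?addbF.
Qed.

(** Forces a time into the open unit interval; for the uniform law this changes
    only a null set. *)
Definition clamp u : R := if 0 < u < 1 then u else 2^-1.

Lemma clamp_itv u : 0 < clamp u < 1.
Proof. by rewrite /clamp; case: ifP => // _; lra. Qed.

Lemma toggle_subproof (p : R * R) (V : even_fset R) :
  even_in_unit_interval (toggle1 (clamp p.1) (toggle1 (clamp p.2) V)).
Proof.
have /andP[/allP V01 Vev] := even_fset_valP V.
apply/andP; split; last by rewrite !odd_toggle1 negbK.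
apply/allP => x; rewrite -[x \in enum_fset _]/(x \in toggle1 _ _) !in_toggle1.
have [xV _|xV] := boolP (x \in even_fset_val V); first exact: V01.
have [->|_] := eqVneq x (clamp p.1); first by rewrite clamp_itv.
by have [->|//] := eqVneq x (clamp p.2); rewrite clamp_itv.
Qed.

(** The symmetric difference of [V] with the two points.  Unlike [Psi] it flips the
    parity of the path at both points even when just one of them, or twice the same
    point, is involved, which makes [path_of_toggle] exact. *)
Definition toggle (p : R * R) (V : even_fset R) : even_fset R :=
  EvenFset (toggle_subproof p V).

Lemma path_of_toggle p (V : even_fset R) t :
  path_of (toggle p V) t =
  path_of V t (+) (clamp p.1 <= t) (+) (clamp p.2 <= t).
Proof. by rewrite /= !path_of_toggle1 addbAC. Qed.

Lemma fresh_time V : exists2 w, 0 < w < 1 & w \notin V.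
Proof.
have [w /andP[w0 w1] wV] :
    exists2 w, 0 < w < 1 & forall x, x \in enum_fset V -> 0 < x -> w < x.
  elim: (enum_fset V) => [|y s [w /andP[w0 w1] IH]].
    by exists 2^-1 => //; lra.
  exists (if 0 < y then Num.min w (y / 2) else w).
    case: ifP => y0; rewrite ?w0 ?w1// lt_min w0 gt_min w1/= andbT; lra.
  move=> x; rewrite inE => /orP[/eqP -> y0|/IH wx x0].
    by rewrite y0 gt_min; apply/orP; right; lra.
  by case: ifP => _; rewrite ?gt_min wx.
by exists w; rewrite ?w0 ?w1//; apply/negP => /wV/(_ w0); rewrite ltxx.
Qed.

Lemma even_fset_eq (U V : even_fset R) :
  even_fset_val U = even_fset_val V -> U = V.
Proof. by move=> UV; apply/val_inj. Qed.

(** When both points or none of them belong to [V], the symmetric difference is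
    [Psi]. *)
Lemma neighbours_toggle1 (r s : R) (U V : even_fset R) :
  0 < r < 1 -> 0 < s < 1 -> r != s -> (r \in even_fset_val V) = (s \in even_fset_val V) ->
  even_fset_val U = toggle1 r (toggle1 s V) -> neighbours U V.
Proof.
move=> r01 s01 rs rsV UE; split.
  move=> UV; have : r \in even_fset_val U = (r \in even_fset_val V) by rewrite UV.
  by rewrite UE !in_toggle1 eqxx (negbTE rs); case: (r \in _).
have PsiE (a b : R) : a != b -> (a \in even_fset_val V) = (b \in even_fset_val V) ->
    toggle1 a (toggle1 b V) = Psi a b V.
  move=> ab abV; apply/fsetP => x.
  rewrite !in_toggle1 /Psi -abV andbb; case: ifP => aV.
    rewrite !inE; have [->|xa] := eqVneq x a.
      by rewrite (negbTE aV) (negbTE ab).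
    by have [->|xb] := eqVneq x b; rewrite -?abV ?(negbTE aV) ?addbF ?orbF.
  move/negbFE: aV => aV; rewrite aV /= !inE.
  have [->|xa] := eqVneq x a; first by rewrite aV (negbTE ab).
  by have [->|xb] := eqVneq x b; rewrite -?abV ?aV ?addbF ?orbF.
have [rs'|sr] := ltP r s.
  by exists r, s; split; rewrite ?rs' -?PsiE//; [case/andP: r01|case/andP: s01].
exists s, r; split; [by case/andP: s01| |by case/andP: r01|].
  by rewrite lt_neqAle eq_sym rs.
by rewrite -PsiE 1?eq_sym// toggle1C.
Qed.

Lemma graph_dist_walk (U V : even_fset R) (w : seq (even_fset R)) :
  path (fun A B => `[< neighbours A B >]) U w -> last U w = V ->
  (graph_dist U V <= (size w)%:R%:E)%E.
Proof. by move=> Uw wV; apply: ereal_inf_lbound; exists w. Qed.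

Lemma graph_dist_self (U : even_fset R) : (graph_dist U U <= 0)%E.
Proof. exact: (@graph_dist_walk U U [::]). Qed.

(** Toggling is one edge of the graph, or no edge, unless exactly one of the two
    points belongs to [V]; then a jump is moved, which takes two edges through a
    fresh auxiliary time. *)
Lemma graph_dist_toggle (p : R * R) (V : even_fset R) :
  (graph_dist (toggle p V) V <= 2%:E)%E.
Proof.
have swap (u v : R) (T : even_fset R) : 0 < u < 1 -> 0 < v < 1 ->
    u \in even_fset_val V -> v \notin even_fset_val V ->
    even_fset_val T = toggle1 u (toggle1 v V) -> (graph_dist T V <= 2%:E)%E.
  move=> u01 v01 uV vV TE.
  have uv : u != v by apply: contraNneq vV => <-.
  have [w w01] := fresh_time (v |` V)%fset; rewrite !inE negb_or => /andP[wv wV].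
  have wu : w != u by apply: contraNneq wV => ->.
  have clampE x : 0 < x < 1 -> clamp x = x by rewrite /clamp => ->.
  (* add v and w, then remove u and w *)
  pose W := toggle (w, v) V.
  have WE : even_fset_val W = toggle1 w (toggle1 v V).
    by rewrite /W /= !clampE.
  apply: (@graph_dist_walk T V [:: W; V]) => //=; rewrite andbT.
  apply/andP; split; apply/asboolP.
    apply: (@neighbours_toggle1 u w) => //; first by rewrite eq_sym.
      rewrite WE !in_toggle1 eqxx uV (negbTE wV) (negbTE uv) (negbTE wv).
      by rewrite eq_sym (negbTE wu).
    by rewrite TE WE toggle1K.
  apply: (@neighbours_toggle1 w v) => //.
  by rewrite (negbTE wV) (negbTE vV).
have u01 := clamp_itv p.1; have v01 := clamp_itv p.2.
have [uv|uv] := eqVneq (clamp p.1) (clamp p.2).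
  suff -> : toggle p V = V.
    by rewrite (le_trans (graph_dist_self V))// lee_fin.
  by apply: even_fset_eq; rewrite /= uv toggle1K.
have [Euv|] := eqVneq (clamp p.1 \in even_fset_val V) (clamp p.2 \in even_fset_val V).
  apply: (@le_trans _ _ 1%:E); last by rewrite lee_fin ler1n.
  apply: (@graph_dist_walk _ _ [:: V]) => //=; rewrite andbT; apply/asboolP.
  exact: neighbours_toggle1 Euv _.
case: (boolP (clamp p.1 \in _)) => uV; case: (boolP (clamp p.2 \in _)) => vV // _.
  exact: swap uV vV _.
by apply: (swap _ _ _ v01 u01 vV uV); rewrite /= toggle1C.
Qed.

End toggling.

(** * The weights of the number of pairs *)

Section hyperbolic_weights.
Context (R : realType).
Implicit Types (a b : R) (k n : nat).

Definition coshR a : R := (expR a + expR (- a)) / 2.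

Lemma coshR_gt0 a : 0 < coshR a.
Proof. by rewrite divr_gt0 ?addr_gt0 ?expR_gt0. Qed.

Definition cosh_coeff a k : R := (a ^+ 2) ^+ k / ((2 * k)`!)%:R.

Lemma cosh_coeff_ge0 a k : 0 <= cosh_coeff a k.
Proof. by rewrite divr_ge0// exprn_ge0// sqr_ge0. Qed.

Lemma cvg_cosh_series a : series (cosh_coeff a) @ \oo --> coshR a.
Proof.
have even_sum n : series (cosh_coeff a) n =
    (series (exp_coeff a) (2 * n)%N + series (exp_coeff (- a)) (2 * n)%N) / 2.
  elim: n => [|n IH]; first by rewrite /series /= !big_geq// addr0 mul0r.
  rewrite mulnS !addSn add0n !seriesS -/(series _ _) IH /exp_coeff/= /cosh_coeff.
  rewrite [a ^+ (2 * n).+1]exprS [(- a) ^+ (2 * n).+1]exprS !exprM sqrrN.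
  set p := (a ^+ 2) ^+ n; set f := (_`!%:R)^-1; set g := (_`!%:R)^-1.
 set x := series _ _; set y := series _ _.
  by field.
rewrite (_ : series (cosh_coeff a) = fun n =>
    (series (exp_coeff a) (2 * n)%N + series (exp_coeff (- a)) (2 * n)%N) / 2).
  have dbl : (fun n => (2 * n)%N) @ \oo --> \oo.
    apply/cvgnyPge => A; near=> n; rewrite mul2n -addnn (leq_trans _ (leq_addr _ _))//.
    by near: n; exact: nbhs_infty_ge.
  have cvg_exp (x : R) : series (exp_coeff x) (2 * n)%N @[n --> \oo] --> expR x.
    apply: (@cvg_comp _ _ _ (fun n => (2 * n)%N) (series (exp_coeff x)) _ \oo) => //.
    exact: is_cvg_series_exp_coeff.
  by apply: cvgMl; apply: cvgD; exact: cvg_exp.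
by apply/funext.
Unshelve. all: by end_near. Qed.

Lemma cosh_series_le a n : \sum_(k < n) cosh_coeff a k <= coshR a.
Proof.
rewrite -(big_mkord xpredT (cosh_coeff a)) -/(series _ n).
rewrite -(cvg_lim _ (@cvg_cosh_series a))//.
apply: nondecreasing_cvgn_le; last by apply/cvg_ex; exists (coshR a); exact: cvg_cosh_series.
by apply: nondecreasing_series => k _ _; exact: cosh_coeff_ge0.
Qed.

(** The derivative of the k-th coefficient with respect to a^2 *)
Definition dcosh_coeff a k : R := k%:R * (a ^+ 2) ^+ k.-1 / ((2 * k)`!)%:R.

Lemma dcosh_coeffS_le a k : k.+1%:R * dcosh_coeff a k.+1 <= cosh_coeff a k / 2.
Proof.
rewrite /dcosh_coeff /cosh_coeff /=.
rewrite mulnS !addSn add0n !factS !natrM.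
have f0 : 0 < ((2 * k)`!)%:R :> R by rewrite ltr0n fact_gt0.
have s0 : 0 <= (a ^+ 2) ^+ k by rewrite exprn_ge0// sqr_ge0.
rewrite mulrA ler_pdivrMr; last by rewrite !mulr_gt0// ltr0n.
rewrite [leRHS](_ : _ = (a ^+ 2) ^+ k * ((2 * k).+2%:R * (2 * k).+1%:R / 2)); last first.
  by field; rewrite gt_eqF.
rewrite [leLHS](_ : _ = (a ^+ 2) ^+ k * (k.+1%:R * k.+1%:R)); last ring.
apply: ler_wpM2l => //.
have k0 : 0 <= k%:R :> R by [].
have -> : (2 * k).+2%:R = 2 * k%:R + 2 :> R by rewrite -addn2 natrD natrM.
have -> : (2 * k).+1%:R = 2 * k%:R + 1 :> R by rewrite -addn1 natrD natrM.
by rewrite -[k.+1%:R]natr1; nra.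
Qed.

(** Up to the factor a^2, this bounds the second moment of the number of pairs:
    k^2 / (2k)! is at most half of 1 / (2k - 2)!. *)
Lemma sum_sqr_dcosh_le a n :
  \sum_(k < n) k%:R * dcosh_coeff a k <= coshR a / 2.
Proof.
case: n => [|n]; first by rewrite big_ord0 divr_ge0// ltW// coshR_gt0.
rewrite big_ord_recl /= mul0r add0r.
apply: (@le_trans _ _ (\sum_(k < n) cosh_coeff a k / 2)).
  by apply: ler_sum => k _; exact: dcosh_coeffS_le.
by rewrite -mulr_suml ler_pM2r ?invr_gt0//; exact: cosh_series_le.
Qed.

(** The first moment follows from the second, since a k <= (k^2 + a^2) / 2. *)
Lemma sum_dcosh_le a n : a * \sum_(k < n) dcosh_coeff a k <= 3 / 4 * coshR a.
Proof.
rewrite mulr_sumr.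
apply: (@le_trans _ _ (\sum_(k < n) (k%:R * dcosh_coeff a k / 2 + cosh_coeff a k / 2))).
  apply: ler_sum => -[[|k] kn] _ /=.
    by rewrite /dcosh_coeff mul0r !mul0r mulr0 add0r divr_ge0// cosh_coeff_ge0.
  rewrite /dcosh_coeff /cosh_coeff /= [(a ^+ 2) ^+ k.+1]exprS.
  set p := (a ^+ 2) ^+ k; set f := (_`!)%:R^-1; set K := k.+1%:R.
  have pf : 0 <= p * f by rewrite mulr_ge0 ?invr_ge0// exprn_ge0// sqr_ge0.
  have h : 0 <= (K - a) ^+ 2 by exact: sqr_ge0.
  have := mulr_ge0 h pf; lra.
rewrite big_split/= -!mulr_suml.
have := sum_sqr_dcosh_le a n; have := cosh_series_le a n; lra.
Qed.

Lemma exprB_le (s r : R) k : 0 <= r -> r <= s ->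
  s ^+ k - r ^+ k <= (s - r) * (k%:R * s ^+ k.-1).
Proof.
move=> r0 rs; have s0 := le_trans r0 rs.
elim: k => [|k IH]; first by rewrite !expr0 subrr mul0r mulr0.
rewrite /= !exprS.
have -> : s * s ^+ k - r * r ^+ k = s * (s ^+ k - r ^+ k) + r ^+ k * (s - r) by ring.
have rks : r ^+ k * (s - r) <= s ^+ k * (s - r).
  by rewrite ler_wpM2r ?subr_ge0// lerXn2r.
have := ler_wpM2l s0 IH => h.
have E : s * ((s - r) * (k%:R * s ^+ k.-1)) = (s - r) * (k%:R * s ^+ k).
  case: k {IH rks h} => [|k]; first by rewrite !mul0r !mulr0.
  by rewrite /= exprS; ring.
by rewrite E in h; rewrite -natr1; lra.
Qed.

Lemma cosh_coeffB_le a b k : b ^+ 2 <= a ^+ 2 ->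
  cosh_coeff a k - cosh_coeff b k <= (a ^+ 2 - b ^+ 2) * dcosh_coeff a k.
Proof.
move=> ba; rewrite /cosh_coeff /dcosh_coeff -mulrBl mulrA.
by rewrite ler_wpM2r ?invr_ge0// exprB_le// sqr_ge0.
Qed.

Lemma coshRB_le a b : 0 <= b -> b <= a ->
  a * (coshR a - coshR b) <= 3 / 4 * (a ^+ 2 - b ^+ 2) * coshR a.
Proof.
move=> b0 ba; have a0 := le_trans b0 ba.
have ba2 : b ^+ 2 <= a ^+ 2 by rewrite lerXn2r.
have cvgB : a * (series (cosh_coeff a) n - series (cosh_coeff b) n) @[n --> \oo]
    --> a * (coshR a - coshR b).
  by apply: cvgMr; apply: cvgB; exact: cvg_cosh_series.
rewrite -(cvg_lim _ cvgB)//; apply: limr_le; first by apply/cvg_ex; eexists; exact: cvgB.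
near=> n; rewrite /series /= -sumrB big_mkord.
apply: (@le_trans _ _ (a * \sum_(k < n) (a ^+ 2 - b ^+ 2) * dcosh_coeff a k)).
  by rewrite ler_wpM2l// ler_sum// => k _; exact: cosh_coeffB_le.
rewrite -mulr_sumr mulrCA [3 / 4 * _]mulrC -mulrA ler_wpM2l ?subr_ge0//.
exact: sum_dcosh_le.
Unshelve. all: by end_near. Qed.

Definition weight a k : R := cosh_coeff a k / coshR a.

Lemma weight_ge0 a k : 0 <= weight a k.
Proof. by rewrite divr_ge0 ?cosh_coeff_ge0// ltW// coshR_gt0. Qed.

Lemma cvg_weight_series a (c : R) :
  series (fun k => weight a k * (c ^+ 2) ^+ k) @ \oo --> coshR (a * c) / coshR a.
Proof.
rewrite (_ : series _ = fun n => series (cosh_coeff (a * c)) n / coshR a).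
  by apply: cvgMl; exact: cvg_cosh_series.
apply/funext => n; rewrite /series /= mulr_suml; apply: eq_bigr => k _.
rewrite /weight /cosh_coeff [(a * c) ^+ 2]exprMn [(a ^+ 2 * _) ^+ k]exprMn.
by set x := (a ^+ 2) ^+ k; set y := (c ^+ 2) ^+ k; field; rewrite gt_eqF ?coshR_gt0//= pnatr_eq0 -lt0n fact_gt0.
Qed.

Lemma sum_weight_le a n : \sum_(k < n) k%:R * weight a k <= 3 / 4 * `|a|.
Proof.
rewrite (_ : \sum_(k < n) _ =
    `|a| * (`|a| * \sum_(k < n) dcosh_coeff `|a| k) / coshR a).
  have -> : coshR a = coshR `|a|.
    by case: (ger0P a) => // _; rewrite /coshR opprK addrC.
  rewrite ler_pdivrMr ?coshR_gt0//.
  by have := ler_wpM2l (normr_ge0 a) (sum_dcosh_le `|a| n); lra.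
rewrite mulrA -expr2 real_normK ?num_real// mulr_sumr mulr_suml; apply: eq_bigr => -[[|k] _] _ /=.
  by rewrite /dcosh_coeff !mul0r mulr0 mul0r.
by rewrite /weight /cosh_coeff /dcosh_coeff /= exprS real_normK ?num_real//; ring.
Qed.

(** The difference of the weights is split into the variation of the coefficient
    and that of the normalisation.  The first part is controlled by the second
    moment at the larger rate, the second by the product of the two first moments,
    which is at most (9/16) a b <= (9/16) a^2. *)
Lemma sum_weightB_le a b n : 0 <= a -> 0 <= b ->
  \sum_(k < n) k%:R * `|weight a k - weight b k| <= 17 / 16 * `|a ^+ 2 - b ^+ 2|.
Proof.
wlog ba : a b / b <= a.
  move=> H a0 b0; have [ba|/ltW ab] := leP b a; first exact: H.
  rewrite distrC (eq_bigr (fun k : 'I_n => k%:R * `|weight b k - weight a k|)).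
    exact: H.
  by move=> k _; rewrite distrC.
move=> a0 b0.
have ba2 : b ^+ 2 <= a ^+ 2 by rewrite lerXn2r.
have Ca := coshR_gt0 a; have Cb := coshR_gt0 b.
(* the hyperbolic cosine increases because each coefficient of its series does *)
have dC : 0 <= coshR a - coshR b.
  have cvgB : series (cosh_coeff a) n - series (cosh_coeff b) n @[n --> \oo]
      --> coshR a - coshR b.
    by apply: cvgB; exact: cvg_cosh_series.
  rewrite -(cvg_lim _ cvgB)//; apply: limr_ge; first by apply/cvg_ex; eexists; exact: cvgB.
  near=> m; rewrite subr_ge0; apply: ler_sum => k _.
  by rewrite ler_wpM2r ?invr_ge0// lerXn2r ?nnegrE ?sqr_ge0.
pose q := (coshR a - coshR b) / (coshR a * coshR b).
have q0 : 0 <= q by rewrite divr_ge0// mulr_ge0// ltW.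
have term k : `|weight a k - weight b k| <=
    (a ^+ 2 - b ^+ 2) / coshR a * dcosh_coeff a k + cosh_coeff b k * q.
  have -> : weight a k - weight b k =
      (cosh_coeff a k - cosh_coeff b k) / coshR a - cosh_coeff b k * q.
    by rewrite /weight /q; field; rewrite !gt_eqF.
  rewrite (le_trans (ler_normB _ _))// [X in _ + X]ger0_norm; last first.
    by rewrite mulr_ge0// cosh_coeff_ge0.
  rewrite lerD2r ger0_norm; last first.
    rewrite divr_ge0 ?(ltW Ca)// subr_ge0.
    by rewrite ler_wpM2r ?invr_ge0// lerXn2r ?nnegrE ?sqr_ge0.
  rewrite mulrAC ler_pM2r ?invr_gt0//; exact: cosh_coeffB_le.
apply: (@le_trans _ _ (\sum_(k < n) k%:R *
    ((a ^+ 2 - b ^+ 2) / coshR a * dcosh_coeff a k + cosh_coeff b k * q))).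
  by apply: ler_sum => k _; rewrite ler_wpM2l.
have -> : \sum_(k < n) k%:R *
    ((a ^+ 2 - b ^+ 2) / coshR a * dcosh_coeff a k + cosh_coeff b k * q) =
   (a ^+ 2 - b ^+ 2) / coshR a * \sum_(k < n) k%:R * dcosh_coeff a k +
   (\sum_(k < n) k%:R * weight b k) * (coshR b * q).
  rewrite mulr_sumr mulr_suml -big_split /=; apply: eq_bigr => k _.
  by rewrite /weight; field; rewrite !gt_eqF.
have h1 : (a ^+ 2 - b ^+ 2) / coshR a * \sum_(k < n) k%:R * dcosh_coeff a k <=
    (a ^+ 2 - b ^+ 2) / 2.
  apply: (@le_trans _ _ ((a ^+ 2 - b ^+ 2) / coshR a * (coshR a / 2))).
    rewrite ler_wpM2l// ?divr_ge0 ?subr_ge0// ?(ltW Ca)//; exact: sum_sqr_dcosh_le.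
  by rewrite mulrA divfK ?gt_eqF.
have h2 : (\sum_(k < n) k%:R * weight b k) * (coshR b * q) <=
    9 / 16 * (a ^+ 2 - b ^+ 2).
  apply: (@le_trans _ _ (3 / 4 * a * (coshR b * q))).
    apply: ler_wpM2r; first by rewrite mulr_ge0// ltW.
    apply: le_trans (sum_weight_le b n) _.
    by rewrite ger0_norm// ler_wpM2l.
  rewrite (_ : _ * (coshR b * q) = 3 / 4 * (a * (coshR a - coshR b)) / coshR a).
    rewrite ler_pdivrMr//; have := coshRB_le b0 ba; lra.
  by rewrite /q; field; rewrite !gt_eqF.
by rewrite ger0_norm ?subr_ge0//; lra.
Unshelve. all: by end_near. Qed.

End hyperbolic_weights.

(** * Integrals against mixtures, images and products of probabilities *)

Section probability_integrals.
Context d (T : measurableType d) (R : realType).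

Lemma bounded_integrable (P : probability T R) (f : T -> R) (C : R) :
  measurable_fun setT f -> (forall x, `|f x| <= C) ->
  P.-integrable setT (EFin \o f).
Proof.
move=> mf fC; apply: measurable_bounded_integrable => //.
  by rewrite [X in (X < _)%E](probability_setT P) ltry.
exists C; split; first exact: num_real.
by move=> x Cx y _ /=; rewrite (le_trans (fC y))// ltW.
Qed.

Lemma Rintegral_cst1 (P : probability T R) (c : R) : \int[P]_x c = c.
Proof. by rewrite Rintegral_cst// [X in fine X](probability_setT P) mulr1. Qed.

Lemma integrable_sub (P : {measure set T -> \bar R}) (f g : T -> R) :
  P.-integrable setT (EFin \o f) -> P.-integrable setT (EFin \o g) ->
  P.-integrable setT (EFin \o (fun x => f x - g x)).
Proof. by move=> fi gi; have := integrableB measurableT fi gi; apply. Qed.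

Lemma integrable_add (P : {measure set T -> \bar R}) (f g : T -> R) :
  P.-integrable setT (EFin \o f) -> P.-integrable setT (EFin \o g) ->
  P.-integrable setT (EFin \o (fun x => f x + g x)).
Proof. by move=> fi gi; have := integrableD measurableT fi gi; apply. Qed.

Lemma integrable_cst (P : probability T R) (c : R) :
  P.-integrable setT (EFin \o (fun=> c)).
Proof. exact: finite_measure_integrable_cst. Qed.

(** The mixture is a series of scaled measures.  Monotone convergence gives the
    claim for nonnegative integrands; a signed g is written as |g| - (|g| - g), a
    difference of nonnegative functions. *)
Lemma mixture (m : nat -> probability T R) (w : nat -> R) :
  (forall k, 0 <= w k) -> series w @ \oo --> (1 : R) ->
  exists M : probability T R, forall (g : T -> R) (C : R),
    measurable_fun setT g -> (forall k, (m k).-integrable setT (EFin \o g)) ->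
    (forall n, \sum_(k < n) w k * \int[m k]_x `|g x| <= C) ->
    [/\ M.-integrable setT (EFin \o g), \int[M]_x `|g x| <= C &
        series (fun k => w k * \int[m k]_x g x) @ \oo --> \int[M]_x g x].
Proof.
move=> w0 w1.
pose mw k : {measure set T -> \bar R} := mscale (NngNum (w0 k)) (m k).
pose M0 : {measure set T -> \bar R} := mseries mw 0.
have EF (u : nat -> R) n : (\sum_(0 <= k < n) (u k)%:E = (series u n)%:E)%E.
  by rewrite sumEFin.
have ge0E (h : T -> R) : measurable_fun setT h -> (forall x, 0 <= h x) ->
    (forall k, (m k).-integrable setT (EFin \o h)) ->
    ((series (fun k => w k * \int[m k]_x h x) n)%:E @[n --> \oo] -->
      \int[M0]_x (h x)%:E)%E.
  move=> mh h0 ih; rewrite ge0_integral_measure_series//; last first.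
  - exact/measurable_EFinP.
  - by move=> x _; rewrite lee_fin.
  have -> : (fun n => (series (fun k => w k * \int[m k]_x h x) n)%:E) =
      (fun n => \sum_(0 <= k < n) \int[mw k]_x (h x)%:E)%E.
    apply/funext => n; rewrite -EF; apply: eq_bigr => k _.
    rewrite ge0_integral_mscale//=.
    - by rewrite EFinM fineK//; exact: (integrable_fin_num _ (ih k)).
    - exact/measurable_EFinP.
    - by move=> x _; rewrite lee_fin.
  by apply: is_cvg_nneseries => k _ _; apply: integral_ge0 => x _; rewrite lee_fin.
have M1 : M0 setT = 1%E.
  have i1 k : (m k).-integrable setT (EFin \o (cst 1 : T -> R)).
    by apply: (@bounded_integrable _ _ 1) => // x; rewrite normr1.
  have := ge0E (cst 1) (measurable_cst _) (fun=> ler01) i1.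
  have -> : (\int[M0]_x ((cst (1 : R) : T -> R) x)%:E = M0 setT)%E.
    by rewrite -[RHS]mul1e -integral_cst.
  move=> h; apply/esym; apply: cvg_unique h => //.
  apply: cvg_EFin; first exact: nearW.
  rewrite (_ : _ \o _ = series w)//; apply/funext => n /=.
  by congr (series _ n); apply/funext => k; rewrite Rintegral_cst1 mulr1.
pose MP := Measure_isProbability.Build _ _ _ (mseries mw 0) M1.
pose M : probability T R := HB.pack (mseries mw 0) MP.
exists M => g C mg ig gC.
have M0E : M = M0 :> (set T -> \bar R) by [].
have ge0 (h : T -> R) (D : R) : measurable_fun setT h -> (forall x, 0 <= h x) ->
    (forall k, (m k).-integrable setT (EFin \o h)) ->
    (forall n, \sum_(k < n) w k * \int[m k]_x h x <= D) ->
    [/\ M.-integrable setT (EFin \o h), \int[M]_x h x <= D &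
        series (fun k => w k * \int[m k]_x h x) @ \oo --> \int[M]_x h x].
  move=> mh h0 ih hD; have := ge0E h mh h0 ih; rewrite -M0E => cvgh.
  have leD : (\int[M]_x (h x)%:E <= D%:E)%E.
    rewrite -(cvg_lim _ cvgh)//; apply: lime_le; first by apply/cvg_ex; eexists; exact: cvgh.
    by apply: nearW => n; rewrite lee_fin /series/= big_mkord.
  have ge0h : (0 <= \int[M]_x (h x)%:E)%E.
    by apply: integral_ge0 => x _; rewrite lee_fin.
  have fin : (\int[M]_x (h x)%:E \is a fin_num)%E.
    by rewrite ge0_fin_numE// (le_lt_trans leD)// ltry.
  split.
  - apply/integrableP; split; first exact/measurable_EFinP.
    rewrite (eq_integral (EFin \o h)) => [|x _ /=]; first by rewrite -ge0_fin_numE.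
    by rewrite ger0_norm.
  - by rewrite -lee_fin fineK.
  - by move: cvgh; rewrite -(fineK fin) => /fine_cvg.
have mng : measurable_fun setT (fun x => `|g x|) by exact: measurableT_comp.
have ing k : (m k).-integrable setT (EFin \o (fun x => `|g x|)).
  exact: (integrable_norm (ig k)).
have [iM leM cvgM] := ge0 _ C mng (fun=> normr_ge0 _) ing gC.
have mh : measurable_fun setT (fun x => `|g x| - g x) by exact: measurable_funB.
have ih k : (m k).-integrable setT (EFin \o (fun x => `|g x| - g x)).
  exact: (integrable_sub (ing k) (ig k)).
have h0 x : 0 <= `|g x| - g x by rewrite subr_ge0 ler_norm.
have hC n : \sum_(k < n) w k * \int[m k]_x (`|g x| - g x) <= C + C.
  apply: (@le_trans _ _ (\sum_(k < n) (w k * \int[m k]_x `|g x| + w k * \int[m k]_x `|g x|))).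
    apply: ler_sum => k _; rewrite -mulrDr ler_wpM2l// (RintegralB measurableT (ing k) (ig k)).
    rewrite lerD2l (le_trans _ (le_normr_Rintegral measurableT (ig k)))//.
    by rewrite -normrN ler_norm.
  by rewrite big_split lerD.
have [iM' _ cvgM'] := ge0 _ _ mh h0 ih hC.
have gE : g = fun x => `|g x| - (`|g x| - g x).
  by apply/funext => x; rewrite opprB addrC subrK.
split=> //.
  by rewrite gE; exact: (integrable_sub iM iM').
rewrite [in X in _ --> X]gE (RintegralB measurableT iM iM').
rewrite (_ : series _ = series (fun k => w k * \int[m k]_x `|g x|) -
   series (fun k => w k * \int[m k]_x (`|g x| - g x))).
  exact: cvgB.
apply/funext => n; rewrite /series /= fctE/= -sumrB; apply: eq_bigr => k _.
by rewrite -mulrBr (RintegralB measurableT (ing k) (ig k)); congr (_ * _); rewrite opprB addrC subrK.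
Qed.

End probability_integrals.

Section image_and_product.
Context d1 d2 (T1 : measurableType d1) (T2 : measurableType d2) (R : realType).

Lemma distribution_Rintegral (P : probability T1 R) (X : {mfun T1 >-> T2})
    (g : T2 -> R) : measurable_fun setT g ->
  P.-integrable setT (EFin \o (g \o X)) ->
  (distribution P X).-integrable setT (EFin \o g) /\
  \int[distribution P X]_y g y = \int[P]_x g (X x).
Proof.
move=> mg ig; split.
  apply: integrable_pushforward => //; exact/measurable_EFinP.
by rewrite /Rintegral integral_distribution//; exact/measurable_EFinP.
Qed.

(** Tonelli, with the inner integral replaced by an upper bound that is integrable
    in the remaining variable. *)
Lemma prod_integrable (P1 : probability T1 R) (P2 : probability T2 R)
    (f : T1 * T2 -> R) (h : T1 -> R) : measurable_fun setT f ->
  P1.-integrable setT (EFin \o h) ->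
  (forall x, P2.-integrable setT (fun y => (f (x, y))%:E)) ->
  (forall x, \int[P2]_y `|f (x, y)| <= h x) ->
  (P1 \x P2)%E.-integrable setT (EFin \o f) /\
  \int[(P1 \x P2)%E]_z `|f z| <= \int[P1]_x h x.
Proof.
move=> mf ih i2 fh.
have mnf : measurable_fun setT (EFin \o (fun z => `|f z|)).
  by apply/measurable_EFinP/measurableT_comp.
have le : (\int[(P1 \x P2)]_z (`|f z|)%:E <= \int[P1]_x (h x)%:E)%E.
  rewrite fubini_tonelli1//= /fubini_F/=.
  apply: ge0_le_integral => //.
  - by move=> x _; apply: integral_ge0 => y _; rewrite lee_fin.
  - apply: (@measurable_fun_fubini_tonelli_F _ _ _ _ _ P2 (EFin \o (fun z => `|f z|))) => //.
    by move=> z; rewrite lee_fin.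
  - by case/integrableP: ih.
  move=> x _; rewrite -[leLHS]fineK ?lee_fin ?fh//.
  exact: (integrable_fin_num _ (integrable_norm (i2 x))).
have lty : (\int[P1]_x (h x)%:E < +oo)%E.
  by rewrite ltey_eq (integrable_fin_num _ ih).
split.
  apply/integrableP; split; first exact/measurable_EFinP.
  exact: le_lt_trans le lty.
apply: fine_le => //.
- by rewrite ge0_fin_numE ?(le_lt_trans le)// integral_ge0.
- exact: integrable_fin_num.
Qed.

Lemma prod_Rintegral1 (P1 : probability T1 R) (P2 : probability T2 R)
    (f : T1 * T2 -> R) : (P1 \x P2)%E.-integrable setT (EFin \o f) ->
  (forall x, P2.-integrable setT (fun y => (f (x, y))%:E)) ->
  P1.-integrable setT (fun x => (\int[P2]_y f (x, y))%:E) /\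
  \int[(P1 \x P2)%E]_z f z = \int[P1]_x \int[P2]_y f (x, y).
Proof.
move=> if12 i2; have := integrable_fubini_F if12; rewrite /fubini_F /=.
have E : (fun x => \int[P2]_y (f (x, y))%:E)%E = (fun x => (\int[P2]_y f (x, y))%:E).
  by apply/funext => x; rewrite fineK//; exact: integrable_fin_num.
rewrite E => iF; split => //.
by rewrite /Rintegral -integral12_prod_meas1// /fubini_F/= E.
Qed.

Lemma prod_Rintegral2 (P1 : probability T1 R) (P2 : probability T2 R)
    (f : T1 * T2 -> R) : (P1 \x P2)%E.-integrable setT (EFin \o f) ->
  (forall y, P1.-integrable setT (fun x => (f (x, y))%:E)) ->
  P2.-integrable setT (fun y => (\int[P1]_x f (x, y))%:E) /\
  \int[(P1 \x P2)%E]_z f z = \int[P2]_y \int[P1]_x f (x, y).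
Proof.
move=> if12 i1; have mf := measurable_int _ if12.
have : P2.-integrable setT (fun y => \int[P1]_x (f (x, y))%:E)%E.
  apply/integrableP; split; first exact: (measurable_fubini_G if12).
  apply: le_lt_trans ((integrable21ltyP P1 P2 mf).1 if12).
  apply: ge0_le_integral => //.
  - by apply: measurableT_comp => //; exact: (measurable_fubini_G if12).
  - apply: (@measurable_fun_fubini_tonelli_G _ _ _ _ _ P1 (abse \o (EFin \o f))) => //=.
    exact: measurableT_comp.
  - move=> y _; apply: le_abse_integral => //; exact: (measurable_int _ (i1 y)).
have E : (fun y => \int[P1]_x (f (x, y))%:E)%E = (fun y => (\int[P1]_x f (x, y))%:E).
  by apply/funext => y; rewrite fineK//; exact: integrable_fin_num.
rewrite E => iG; split => //.
by rewrite /Rintegral -integral21_prod_meas1// /fubini_G/= E.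
Qed.

Lemma prod_RintegralM (P1 : probability T1 R) (P2 : probability T2 R)
    (f : T1 -> R) (g : T2 -> R) : measurable_fun setT f -> measurable_fun setT g ->
  (forall x, `|f x| <= 1) -> (forall y, `|g y| <= 1) ->
  \int[(P1 \x P2)%E]_z (f z.1 * g z.2) = \int[P1]_x f x * \int[P2]_y g y.
Proof.
move=> mf mg f1 g1.
have ig : P2.-integrable setT (EFin \o g) by exact: bounded_integrable g1.
have iF : P1.-integrable setT (EFin \o f) by exact: bounded_integrable f1.
have fg x y : `|f x * g y| <= 1 by rewrite normrM mulr_ile1.
have i2 x : P2.-integrable setT (fun y => (f x * g y)%:E).
  by apply: (bounded_integrable _ _ (fg x)); exact: measurable_funM.
have if12 : (P1 \x P2)%E.-integrable setT (EFin \o (fun z => f z.1 * g z.2)).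
  apply: (@bounded_integrable _ _ _ _ _ 1) => [|z]; last exact: fg.
  by apply: measurable_funM; apply: measurableT_comp.
rewrite (prod_Rintegral1 if12 i2).2/=.
under eq_Rintegral do rewrite RintegralZl//.
by rewrite RintegralZr.
Qed.

End image_and_product.

(** * The bridge on one coordinate *)

Section one_dimensional_bridge.
Context (R : realType).
Local Notation T := (even_fset R).
Local Notation mR := (measurableTypeR R).
Implicit Types (V : T) (s : seq R) (t : R).

Lemma measurable_path_of t : 0 <= t <= 1 -> measurable [set V : T | path_of V t].
Proof. by move=> t01; apply: sub_sigma_algebra; exists t. Qed.

Lemma measurable_addb d (S : measurableType d) (f g : S -> bool) :
  measurable [set x | f x] -> measurable [set x | g x] ->
  measurable [set x | f x (+) g x].
Proof.
move=> mf mg; rewrite (_ : [set x | _] = ([set x | f x] `\` [set x | g x]) `|`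
    ([set x | g x] `\` [set x | f x])).
  by apply: measurableU; exact: measurableD.
apply/seteqP; split => x /=.
  by case: (f x) (g x) => -[] // _; [left|right].
by case: (f x) (g x) => -[] // [] [].
Qed.

Lemma measurable_clamp_le t : measurable [set u : mR | clamp u <= t].
Proof.
rewrite (_ : [set u | _] = (`]0%R, 1%R[ `&` `]-oo, t]) `|`
    (~` `]0%R, 1%R[ `&` [set _ | 2^-1 <= t])).
  apply: measurableU; apply: measurableI => //; first exact: measurableC.
  have [h|h] := boolP (2^-1 <= t).
    by rewrite (_ : [set _ | _] = setT)//; apply/seteqP; split.
  by rewrite (_ : [set _ | _] = set0)//; apply/seteqP; split.
apply/seteqP; split => u /=; rewrite /clamp !in_itv/=.
  by case: ifP => h ut; [left|right].
by case: ifP => h [] [] //.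
Qed.

Definition toggle_map (z : T * (mR * mR)) : T := toggle z.2 z.1.

Lemma measurable_toggle_map : measurable_fun setT toggle_map.
Proof.
apply: (@measurability _ _ _ _ _ _ (evaluation_sets R)) => //.
move=> _ [_ [t [t01 ->]] <-]; rewrite setTI.
rewrite (_ : _ @^-1` _ = [set z : T * (mR * mR) |
   path_of z.1 t (+) (clamp z.2.1 <= t) (+) (clamp z.2.2 <= t)]); last first.
  by apply/seteqP; split => z /=; rewrite /toggle_map path_of_toggle.
have pre d (S : measurableType d) (f : T * (mR * mR) -> S) (A : set S) :
    measurable_fun setT f -> measurable A -> measurable (f @^-1` A).
  by move=> mf mA; rewrite -[X in measurable X]setTI; exact: mf.
apply: measurable_addb; first apply: measurable_addb.
- exact: (pre _ _ fst _ _ (measurable_path_of t01)).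
- apply: (pre _ _ (fst \o snd) _ _ (measurable_clamp_le t)).
  exact: measurableT_comp.
- apply: (pre _ _ (snd \o snd) _ _ (measurable_clamp_le t)).
  exact: measurableT_comp.
Qed.

HB.instance Definition _ :=
  isMeasurableFun.Build _ _ _ _ toggle_map measurable_toggle_map.

Definition unif : probability mR R := uniform_prob (@ltr01 R).

Definition toggle_step (P : probability T R) : probability T R :=
  distribution (P \x (unif \x unif))%E toggle_map.

Definition toggle_law (k : nat) : probability T R := iter k toggle_step (dirac point).

(** Walsh functions of the path: they separate laws and, unlike indicators, are only
    multiplied by a scalar when a point is toggled. *)
Definition chi s V : R := \prod_(t <- s) (-1) ^+ path_of V t.

(** The factor by which toggling the point [u] multiplies [chi s] *)
Definition eps s (u : R) : R := \prod_(t <- s) (-1) ^+ (clamp u <= t)%R.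

Lemma normr_prod_sign (I : Type) (r : seq I) (b : I -> bool) :
  `|\prod_(i <- r) (-1) ^+ b i| <= 1 :> R.
Proof.
by rewrite normr_prod big1// => i _; rewrite normrX normrN1 expr1n.
Qed.

Lemma chi_toggle s p V : chi s (toggle p V) = chi s V * (eps s p.1 * eps s p.2).
Proof.
rewrite /chi /eps -!big_split /=; apply: eq_bigr => t _.
by rewrite path_of_toggle !signr_addb mulrA.
Qed.

Lemma chi_point s : chi s point = 1.
Proof.
rewrite /chi big1// => t _; rewrite /path_of.
rewrite (_ : [fset _ in _ | _]%fset = fset0) ?cardfs0//.
by apply/fsetP => x; rewrite !inE.
Qed.

Lemma measurable_sign d (S : measurableType d) (b : S -> bool) :
  measurable [set x | b x] -> measurable_fun setT (fun x => (-1) ^+ b x : R).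
Proof.
move=> mb; rewrite (_ : (fun x => _) = (fun x => if b x then -1 else 1)); last first.
  by apply/funext => x; case: (b x).
by apply: measurable_fun_ifT => //; apply: (@measurable_fun_bool _ _ _ _ true); rewrite setTI.
Qed.

Lemma measurable_chi s : {in s, forall t, 0 <= t <= 1} -> measurable_fun setT (chi s).
Proof.
move=> s01; apply: measurable_prod => t ts.
by apply: measurable_sign; apply: measurable_path_of; exact: s01.
Qed.

Lemma measurable_eps s : measurable_fun [set: mR] (eps s).
Proof.
apply: (@measurable_prod _ mR) => t _.
apply: (@measurable_sign _ mR (fun u => clamp u <= t)).
exact: measurable_clamp_le.
Qed.

Lemma Rintegral_dirac (f : T -> R) x : measurable_fun setT f ->
  \int[dirac x]_y f y = f x.
Proof.
move=> mf; rewrite /Rintegral integral_dirac//; last exact/measurable_EFinP.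
by rewrite diracT mul1e.
Qed.

(** [chi s] is an eigenfunction of adding a pair: the two new points contribute
    independent factors with the same mean. *)
Lemma toggle_law_chi k s : {in s, forall t, 0 <= t <= 1} ->
  \int[toggle_law k]_V chi s V = ((\int[unif]_u eps s u) ^+ 2) ^+ k.
Proof.
move=> s01; have mchi := measurable_chi s01; have meps := measurable_eps s.
have chi1 V : `|chi s V| <= 1 by exact: normr_prod_sign.
have eps1 u : `|eps s u| <= 1 by exact: normr_prod_sign.
elim: k => [|k IH]; first by rewrite [LHS]Rintegral_dirac// chi_point.
rewrite exprSr -IH expr2 -(prod_RintegralM unif unif meps meps eps1 eps1).
rewrite -(prod_RintegralM _ (unif \x unif)%E mchi)//; last 2 first.
- by apply: measurable_funM; apply: measurableT_comp.
- by move=> p; rewrite normrM mulr_ile1.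
rewrite [LHS](distribution_Rintegral _ _).2//.
  by apply: eq_Rintegral => z _; rewrite /= /toggle_map chi_toggle.
apply: (@bounded_integrable _ _ _ _ _ 1) => [|z]; last exact: chi1.
exact: measurableT_comp.
Qed.

(** All that the argument uses of a function that is 1-Lipschitz for the graph
    distance *)
Definition toggle_lipschitz (g : T -> R) : Prop :=
  forall p V, `|g (toggle p V) - g V| <= 2.

(** Starting from the empty set, each of the [k] pairs moves [g] by at most 2. *)
Lemma toggle_law_lipschitz k (g : T -> R) :
  measurable_fun setT g -> toggle_lipschitz g ->
  (toggle_law k).-integrable setT (EFin \o (fun V => g V - g point)) /\
  \int[toggle_law k]_V `|g V - g point| <= 2 * k%:R.
Proof.
move=> mg lg; have mh : measurable_fun setT (fun V => g V - g point).
  exact: measurable_funB.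
have mnh : measurable_fun setT (fun V => `|g V - g point|) by exact: measurableT_comp.
elim: k => [|k [IHi IH]].
  split; last by rewrite [leLHS]Rintegral_dirac// subrr normr0 mulr0.
  apply/integrableP; split; first exact/measurable_EFinP.
  rewrite integral_dirac//; last by apply: measurableT_comp => //; exact/measurable_EFinP.
  by rewrite diracT mul1e /= subrr normr0 ltry.
pose f (z : T * (mR * mR)) := g (toggle_map z) - g point.
have mf : measurable_fun setT f by exact: (measurableT_comp mh measurable_toggle_map).
have f_le V p : `|f (V, p)| <= 2 + `|g V - g point|.
  rewrite /f (_ : _ - _ = (g (toggle p V) - g V) + (g V - g point)); last by rewrite subrKA.
  by rewrite (le_trans (ler_normD _ _))// lerD2r lg.
have i2 V : (unif \x unif)%E.-integrable setT (fun p => (f (V, p))%:E).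
  apply: (bounded_integrable _ _ (f_le V)).
  exact: measurableT_comp mf (pair1_measurable V).
have i1 : (toggle_law k).-integrable setT (EFin \o (fun V => 2 + `|g V - g point|)).
  exact: (integrable_add (integrable_cst _ _) (integrable_norm IHi)).
have le2 V : \int[(unif \x unif)%E]_p `|f (V, p)| <= 2 + `|g V - g point|.
  rewrite -[leRHS](Rintegral_cst1 (unif \x unif)%E); apply: le_Rintegral => //.
    exact: (integrable_norm (i2 V)).
  exact: integrable_cst.
have [if12 le12] := prod_integrable mf i1 i2 le2.
have [iD eD] := distribution_Rintegral (X := toggle_map) mh if12.
split; first exact: iD.
rewrite (distribution_Rintegral (X := toggle_map) mnh (integrable_norm if12)).2.
apply: (le_trans le12).
rewrite RintegralD//.
- rewrite Rintegral_cst1 -[k.+1%:R]natr1; move: IH; lra.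
- exact: integrable_cst.
- exact: (integrable_norm IHi).
Qed.

Lemma cvg_weight1 (a : R) : series (weight a) @ \oo --> (1 : R).
Proof.
have := @cvg_weight_series R a 1; rewrite mulr1 divff ?gt_eqF ?coshR_gt0//.
rewrite (_ : (fun k => _) = weight a)//.
by apply/funext => k; rewrite !expr1n mulr1.
Qed.

(** The conditional law of a Poisson process of rate [a] given that it has an even
    number of points.  The weights depend on [a] through its square. *)
Definition bridge1 (a : R) : probability T R :=
  sval (cid (mixture toggle_law (weight_ge0 a) (cvg_weight1 a))).

Lemma bridge1_chi a s : {in s, forall t, 0 <= t <= 1} ->
  \int[bridge1 a]_V chi s V = coshR (a * \int[unif]_u eps s u) / coshR a.
Proof.
move=> s01; have chi1 V : `|chi s V| <= 1 by exact: normr_prod_sign.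
have ichi k : (toggle_law k).-integrable setT (EFin \o chi s).
  exact: bounded_integrable (measurable_chi s01) chi1.
have le1 n : \sum_(k < n) weight a k * \int[toggle_law k]_V `|chi s V| <= 1.
  have := cvg_weight1 a => /cvg_lim <-//.
  apply: (@le_trans _ _ (series (weight a) n)).
    rewrite /series /= big_mkord; apply: ler_sum => k _.
    rewrite -[leRHS]mulr1 ler_wpM2l ?weight_ge0//.
    rewrite -(Rintegral_cst1 (toggle_law k) 1); apply: le_Rintegral => //.
      exact: (integrable_norm (ichi k)).
    exact: integrable_cst.
  apply: nondecreasing_cvgn_le; last by apply/cvg_ex; exists 1; exact: cvg_weight1.
  by apply: nondecreasing_series => k _ _; exact: weight_ge0.
rewrite /bridge1; case: cid => M /= HM.
have [_ _ cvgM] := HM _ _ (measurable_chi s01) ichi le1.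
apply/esym; apply: cvg_unique (@cvg_weight_series R a (\int[unif]_u eps s u)) _ => //.
rewrite (_ : (fun k => _) = (fun k => weight a k * \int[toggle_law k]_V chi s V))//.
by apply/funext => k; rewrite toggle_law_chi.
Qed.

Lemma bridge1_series a (g : T -> R) : measurable_fun setT g -> toggle_lipschitz g ->
  [/\ (bridge1 a).-integrable setT (EFin \o (fun V => g V - g point)),
      \int[bridge1 a]_V `|g V - g point| <= 3 / 2 * `|a| &
      series (fun k => weight a k * \int[toggle_law k]_V (g V - g point)) @ \oo -->
      \int[bridge1 a]_V (g V - g point)].
Proof.
move=> mg lg; rewrite /bridge1; case: cid => M /= HM.
apply: HM.
- exact: measurable_funB.
- by move=> k; case: (toggle_law_lipschitz k mg lg).
move=> n; apply: (@le_trans _ _ (2 * \sum_(k < n) k%:R * weight a k)).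
  rewrite mulr_sumr; apply: ler_sum => k _; rewrite mulrA [leRHS]mulrC ler_wpM2l ?weight_ge0//.
  by case: (toggle_law_lipschitz k mg lg).
by have := sum_weight_le a n; lra.
Qed.

Lemma bridge1_integrable a (g : T -> R) : measurable_fun setT g ->
  toggle_lipschitz g -> (bridge1 a).-integrable setT (EFin \o g).
Proof.
move=> mg lg; have [ig _ _] := bridge1_series a mg lg.
have := integrable_add ig (integrable_cst (bridge1 a) (g point)).
by rewrite (_ : (fun _ => _) = g)//; apply/funext => V; rewrite subrK.
Qed.

(** Both laws mix the same sequence [toggle_law], and the centred mean of [g] under
    its k-th term is at most 2k in absolute value. *)
Lemma bridge1_wasserstein a b (g : T -> R) : 0 <= a -> 0 <= b ->
  measurable_fun setT g -> toggle_lipschitz g ->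
  `|\int[bridge1 a]_V g V - \int[bridge1 b]_V g V| <= 17 / 8 * `|a ^+ 2 - b ^+ 2|.
Proof.
move=> a0 b0 mg lg.
have center c : \int[bridge1 c]_V g V = \int[bridge1 c]_V (g V - g point) + g point.
  have [ig _ _] := bridge1_series c mg lg.
  rewrite RintegralB//; last exact: integrable_cst.
    by rewrite Rintegral_cst1 subrK.
  exact: bridge1_integrable.
rewrite (center a) (center b) opprD addrACA subrr addr0.
have [_ _ ca] := bridge1_series a mg lg; have [_ _ cb] := bridge1_series b mg lg.
have cab : `|series (fun k => weight a k * \int[toggle_law k]_V (g V - g point)) n -
    series (fun k => weight b k * \int[toggle_law k]_V (g V - g point)) n| @[n --> \oo]
    --> `|\int[bridge1 a]_V (g V - g point) - \int[bridge1 b]_V (g V - g point)|.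
  by apply: cvg_norm; apply: cvgB; [exact: ca|exact: cb].
rewrite -(cvg_lim _ cab)//; apply: limr_le; first by apply/cvg_ex; eexists; exact: cab.
near=> n => /=; rewrite /series /= -sumrB big_mkord.
apply: (le_trans (ler_norm_sum _ _ _)).
apply: (@le_trans _ _ (2 * \sum_(k < n) k%:R * `|weight a k - weight b k|)).
  rewrite mulr_sumr; apply: ler_sum => k _.
  rewrite -mulrBl normrM mulrC mulrA ler_wpM2r//.
  have [ig le_k] := toggle_law_lipschitz k mg lg.
  exact: le_trans (le_normr_Rintegral measurableT ig) le_k.
by have := @sum_weightB_le R a b n a0 b0; lra.
Unshelve. all: by end_near. Qed.

End one_dimensional_bridge.

(** * Independent coordinates *)

Section product_bridge.
Context (R : realType) (d : nat).
Local Notation T := (even_fset R).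
Local Notation TT := (d.-tuple (even_fset R)).
Implicit Types (U : TT) (V : T) (i j : 'I_d) (a b : 'I_d -> R) (l : seq 'I_d)
  (tau : seq ('I_d * R)).

Definition upd i V U : TT := [tuple if j == i then V else tnth U j | j < d].

Lemma tnth_upd i V U j : tnth (upd i V U) j = if j == i then V else tnth U j.
Proof. by rewrite tnth_mktuple. Qed.

Lemma upd_upd i V V' U : upd i V (upd i V' U) = upd i V U.
Proof. by apply: eq_from_tnth => j; rewrite !tnth_upd; case: eqP. Qed.

Lemma updC i j V V' U : i != j -> upd i V (upd j V' U) = upd j V' (upd i V U).
Proof.
move=> ij; apply: eq_from_tnth => k; rewrite !tnth_upd.
by have [->|_] := eqVneq k i; case: eqP => // E; rewrite E eqxx in ij.
Qed.

Definition upd_map i (z : T * TT) : TT := upd i z.1 z.2.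

Lemma measurable_upd_map i : measurable_fun setT (upd_map i).
Proof.
apply/measurable_fun_tnthP => j; rewrite /comp /upd_map.
rewrite (_ : (fun z : T * TT => _) = if j == i then fst else fun z => tnth z.2 j); last first.
  by apply/funext => z; rewrite tnth_upd; case: eqP.
case: eqP => _; first exact: measurable_fst.
by apply: (measurableT_comp (f := fun U : TT => tnth U j)) => //; exact: measurable_tnth.
Qed.

HB.instance Definition _ (i : 'I_d) :=
  @isMeasurableFun.Build _ _ (T * TT)%type TT (upd_map i) (measurable_upd_map i).

Definition empty_paths : TT := [tuple point | _ < d].

Lemma upd_empty i : upd i point empty_paths = empty_paths.
Proof. by apply: eq_from_tnth => j; rewrite tnth_upd !tnth_mktuple; case: ifP. Qed.

(** The coordinates listed in [l] are drawn independently, the others are left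
    without jumps.  Building the product along a list allows to change the rates
    one coordinate at a time. *)
Fixpoint bridge_product a l : probability TT R :=
  if l is i :: l' then distribution (bridge1 (a i) \x bridge_product a l')%E (upd_map i)
  else dirac empty_paths.

Definition tuple_lipschitz (f : TT -> R) : Prop :=
  forall U i p, `|f (upd i (toggle p (tnth U i)) U) - f U| <= 2.

Lemma lipschitz1_toggle (f : TT -> R) : lipschitz1 f -> tuple_lipschitz f.
Proof.
move=> lf U i p; rewrite -lee_fin (le_trans (lf _ _))// /prod_dist.
apply: (@le_trans _ _ (\sum_(j < d) (if j == i then 2 else 0)%:E)%E).
  apply: lee_sum => j _; rewrite tnth_upd; case: eqP => [->|_].
    exact: graph_dist_toggle.
  exact: graph_dist_self.
by rewrite sumEFin lee_fin -big_mkcond big_pred1_eq.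
Qed.

Lemma tuple_lipschitz_coord f i U : tuple_lipschitz f ->
  toggle_lipschitz (fun V => f (upd i V U)).
Proof.
move=> lf p V; have := lf (upd i V U) i p.
by rewrite tnth_upd eqxx upd_upd.
Qed.

Lemma tuple_lipschitz_others f i V : tuple_lipschitz f ->
  tuple_lipschitz (fun U => f (upd i V U)).
Proof.
move=> lf U j p; have [->|ij] := eqVneq j i.
  by rewrite upd_upd subrr normr0.
have := lf (upd i V U) j p.
by rewrite tnth_upd (negbTE ij) updC.
Qed.

Lemma measurable_upd_coord f i U : measurable_fun setT f ->
  measurable_fun setT (fun V => f (upd i V U) : R).
Proof.
move=> mf.
exact: measurableT_comp (measurableT_comp mf (measurable_upd_map i)) (pair2_measurable U).
Qed.

Lemma measurable_upd_others f i V : measurable_fun setT f ->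
  measurable_fun setT (fun U => f (upd i V U) : R).
Proof.
move=> mf.
exact: measurableT_comp (measurableT_comp mf (measurable_upd_map i)) (pair1_measurable V).
Qed.

Lemma uncenter_integrable (P : probability TT R) (f : TT -> R) (c : R) :
  P.-integrable setT (EFin \o (fun U => f U - c)) -> P.-integrable setT (EFin \o f).
Proof.
move=> h; have := integrable_add h (integrable_cst P c).
by rewrite (_ : (fun _ => _) = f)//; apply/funext => V; rewrite subrK.
Qed.

(** The induction step for [bridge_product_lipschitz], stated for a general law [P]
    of the other coordinates and a free rate [c], as laws with mixed rates also
    occur in [bridge_product_wasserstein]. *)
Lemma upd_integrable c i (P : probability TT R) (C : R) (f : TT -> R) :
  (forall g, measurable_fun setT g -> tuple_lipschitz g ->
    P.-integrable setT (EFin \o (fun U => g U - g empty_paths)) /\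
    \int[P]_U `|g U - g empty_paths| <= C) ->
  measurable_fun setT f -> tuple_lipschitz f ->
  (bridge1 c \x P)%E.-integrable setT
    (EFin \o (fun z => f (upd_map i z) - f empty_paths)) /\
  \int[(bridge1 c \x P)%E]_z `|f (upd_map i z) - f empty_paths| <= C + 3 / 2 * `|c|.
Proof.
move=> PC mf lf.
pose g V := f (upd i V empty_paths).
have mg : measurable_fun setT g by exact: measurable_upd_coord.
have lg : toggle_lipschitz g by exact: tuple_lipschitz_coord.
have gpt : g point = f empty_paths by rewrite /g upd_empty.
have [ig leg _] := bridge1_series c mg lg; rewrite gpt in ig leg.
have mF : measurable_fun setT (fun z => f (upd_map i z) - f empty_paths).
  apply: measurable_funB => //; exact: measurableT_comp mf (measurable_upd_map i).
have mV V : measurable_fun setT (fun U => f (upd i V U)) by exact: measurable_upd_others.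
have PV V := PC _ (mV V) (tuple_lipschitz_others i V lf).
have iV V : P.-integrable setT (EFin \o (fun U => f (upd i V U) - f empty_paths)).
  have := integrable_add (PV V).1 (integrable_cst P (g V - f empty_paths)).
  by rewrite (_ : (fun U => _ + _) = fun U => f (upd i V U) - f empty_paths)//;
     apply/funext => U; rewrite /g subrKA.
have ih : (bridge1 c).-integrable setT (EFin \o (fun V => C + `|g V - f empty_paths|)).
  exact: (integrable_add (integrable_cst _ _) (integrable_norm ig)).
have leV V : \int[P]_U `|f (upd i V U) - f empty_paths| <= C + `|g V - f empty_paths|.
  have iPV := integrable_norm (PV V).1.
  apply: (@le_trans _ _ (\int[P]_U (`|f (upd i V U) - g V| + `|g V - f empty_paths|))).
    apply: le_Rintegral => //; first exact: (integrable_norm (iV V)).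
      exact: (integrable_add iPV (integrable_cst _ _)).
    move=> U _; rewrite (le_trans _ (ler_normD _ _))//.
    by rewrite subrKA.
  rewrite RintegralD//; last exact: integrable_cst.
  by rewrite Rintegral_cst1 lerD2r; exact: (PV V).2.
have [iF leF] := prod_integrable mF ih iV leV.
split=> //; apply: (le_trans leF).
rewrite RintegralD//; last 2 first.
- exact: integrable_cst.
- exact: (integrable_norm ig).
by rewrite Rintegral_cst1 lerD2l.
Qed.

Lemma bridge_product_lipschitz a l (f : TT -> R) :
  measurable_fun setT f -> tuple_lipschitz f ->
  (bridge_product a l).-integrable setT (EFin \o (fun U => f U - f empty_paths)) /\
  \int[bridge_product a l]_U `|f U - f empty_paths| <= \sum_(i <- l) 3 / 2 * `|a i|.
Proof.
elim: l f => [|i l IH] f mf lf.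
  have mh : measurable_fun setT (fun U => f U - f empty_paths).
    exact: measurable_funB.
  rewrite big_nil; split; last first.
    rewrite [leLHS]/Rintegral integral_dirac//.
      by rewrite diracT mul1e /= subrr normr0.
    by apply/measurable_EFinP/measurableT_comp.
  apply/integrableP; split; first exact/measurable_EFinP.
  rewrite integral_dirac//; last by apply: measurableT_comp => //; exact/measurable_EFinP.
  by rewrite diracT mul1e /= subrr normr0 ltry.
have [iF leF] := upd_integrable (a i) i IH mf lf.
have mh : measurable_fun setT (fun U => f U - f empty_paths) by exact: measurable_funB.
have mnh : measurable_fun setT (fun U => `|f U - f empty_paths|) by exact: measurableT_comp.
have [iD _] := distribution_Rintegral (X := upd_map i) mh iF.
split; first exact: iD.
rewrite (distribution_Rintegral (X := upd_map i) mnh (integrable_norm iF)).2.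
by rewrite big_cons addrC.
Qed.

Lemma Rintegral_dist_le d' (S : measurableType d') (P : probability S R)
    (g h : S -> R) (c : R) :
  P.-integrable setT (EFin \o g) -> P.-integrable setT (EFin \o h) ->
  (forall x, `|g x - h x| <= c) -> `|\int[P]_x g x - \int[P]_x h x| <= c.
Proof.
move=> ig ih gh; rewrite -RintegralB//.
have igh := integrable_sub ig ih.
apply: (le_trans (le_normr_Rintegral measurableT igh)).
rewrite -[leRHS](Rintegral_cst1 P); apply: le_Rintegral => //.
  exact: (integrable_norm igh).
exact: integrable_cst.
Qed.

Lemma upd_integrable_bridge a l c i (f : TT -> R) :
  measurable_fun setT f -> tuple_lipschitz f ->
  (bridge1 c \x bridge_product a l)%E.-integrable setT (EFin \o (f \o upd_map i)).
Proof.
move=> mf lf.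
have [iF _] := upd_integrable c i (bridge_product_lipschitz a l) mf lf.
have := integrable_add iF (integrable_cst _ (f empty_paths)).
by rewrite (_ : (fun _ => _) = f \o upd_map i)//; apply/funext => V; rewrite /= subrK.
Qed.

(** The new coordinate is integrated first when its own rate changes, last when the
    rates of the other coordinates change; Fubini lets both orders coexist. *)
Lemma bridge_product_wasserstein a b l (f : TT -> R) :
  (forall i, 0 <= a i) -> (forall i, 0 <= b i) ->
  measurable_fun setT f -> tuple_lipschitz f ->
  `|\int[bridge_product a l]_U f U - \int[bridge_product b l]_U f U| <=
  \sum_(i <- l) 17 / 8 * `|a i ^+ 2 - b i ^+ 2|.
Proof.
move=> a0 b0; elim: l f => [|i l IH] f mf lf.
  by rewrite subrr normr0 big_nil.
have iF c e := upd_integrable_bridge e l c i mf lf.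
have iV e V : (bridge_product e l).-integrable setT (fun U => (f (upd_map i (V, U)))%:E).
  apply: (@uncenter_integrable _ (fun U => f (upd i V U)) (f (upd i V empty_paths))).
  apply: (bridge_product_lipschitz e l _ _).1; first exact: measurable_upd_others.
  exact: tuple_lipschitz_others.
have iU c U : (bridge1 c).-integrable setT (fun V => (f (upd_map i (V, U)))%:E).
  apply: (@bridge1_integrable _ _ (fun V => f (upd i V U))).
    exact: measurable_upd_coord.
  exact: tuple_lipschitz_coord.
rewrite big_cons (distribution_Rintegral (X := upd_map i) mf (iF (a i) a)).2.
rewrite (distribution_Rintegral (X := upd_map i) mf (iF (b i) b)).2.
(* compare through the law with rate a on coordinate i and rates b on l *)
apply: le_trans (ler_distD (\int[(bridge1 (a i) \x bridge_product b l)%E]_z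
  f (upd_map i z)) _ _) _.
rewrite addrC; apply: lerD.
  have [ia ->] := prod_Rintegral2 (iF (a i) b) (iU (a i)).
  have [ib ->] := prod_Rintegral2 (iF (b i) b) (iU (b i)).
  apply: Rintegral_dist_le => // U; apply: bridge1_wasserstein => //.
    exact: (@measurable_upd_coord f i U).
  exact: (@tuple_lipschitz_coord f i U).
have [ia ->] := prod_Rintegral1 (iF (a i) a) (iV a).
have [ib ->] := prod_Rintegral1 (iF (a i) b) (iV b).
apply: Rintegral_dist_le => // V; apply: IH.
  exact: measurable_upd_others.
exact: tuple_lipschitz_others.
Qed.

Definition tuple_chi tau U : R := \prod_(p <- tau) (-1) ^+ path_of (tnth U p.1) p.2.

Definition times i tau : seq R := [seq p.2 | p <- tau & p.1 == i].

Lemma times_filter i j tau : j != i -> times j [seq p <- tau | p.1 != i] = times j tau.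
Proof.
move=> ji; rewrite /times -filter_predI; congr map; apply: eq_filter => p /=.
by case: eqP => // ->; rewrite ji.
Qed.

Lemma tuple_chi_upd tau i V U : tuple_chi tau (upd i V U) =
  chi (times i tau) V * tuple_chi [seq p <- tau | p.1 != i] U.
Proof.
rewrite /tuple_chi /chi /times big_map !big_filter (bigID (fun p => p.1 == i))/=.
by congr (_ * _); apply: eq_bigr => p; rewrite tnth_upd; [move=> ->|move/negbTE => ->].
Qed.

Lemma measurable_tuple_chi tau : {in tau, forall p, 0 <= p.2 <= 1} ->
  measurable_fun setT (tuple_chi tau).
Proof.
move=> tau01; apply: measurable_prod => p ptau; apply: measurable_sign.
have := @measurable_tnth _ T d p.1 measurableT _ (measurable_path_of (tau01 p ptau)).
by rewrite setTI.
Qed.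

(** A product of signs factors over the coordinates. *)
Lemma bridge_product_chi a l tau : uniq l -> {in tau, forall p, p.1 \in l} ->
  {in tau, forall p, 0 <= p.2 <= 1} ->
  \int[bridge_product a l]_U tuple_chi tau U =
  \prod_(i <- l) (coshR (a i * \int[@unif R]_u eps (times i tau) u) / coshR (a i)).
Proof.
elim: l tau => [|i l IH] tau /=.
  move=> _; case: tau => [_ _|p tau /(_ p)]; last by rewrite !inE eqxx => /(_ isT).
  rewrite big_nil /Rintegral integral_dirac//; last first.
    by apply/measurable_EFinP; apply: measurable_tuple_chi => p; rewrite in_nil.
  by rewrite diracT mul1e /= /tuple_chi big_nil.
move=> /andP[il ul] taul tau01; rewrite big_cons.
have chi1 U : `|tuple_chi tau U| <= 1 by exact: normr_prod_sign.
have mchi := measurable_tuple_chi tau01.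
rewrite (distribution_Rintegral (X := upd_map i) mchi _).2; last first.
  apply: (@bounded_integrable _ _ _ _ _ 1) => [|z]; last exact: chi1.
  exact: measurableT_comp mchi (measurable_upd_map i).
have tau01' : {in [seq p <- tau | p.1 != i], forall p, 0 <= p.2 <= 1}.
  by move=> p; rewrite mem_filter => /andP[_]; exact: tau01.
have times01 : {in times i tau, forall t, 0 <= t <= 1}.
  by move=> t /mapP[p]; rewrite mem_filter => /andP[_ /tau01 h ->].
under eq_Rintegral do rewrite /upd_map tuple_chi_upd.
rewrite prod_RintegralM; first last.
- by move=> U; exact: normr_prod_sign.
- by move=> V; exact: normr_prod_sign.
- exact: measurable_tuple_chi.
- exact: measurable_chi.
rewrite bridge1_chi// IH//.
  congr (_ * _); apply: eq_big_seq => j jl; rewrite times_filter//.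
  exact: memPn il j jl.
by move=> p; rewrite mem_filter => /andP[/negbTE pi /taul]; rewrite inE pi.
Qed.

End product_bridge.

(** * Finite-dimensional events determine a law *)

Section cylinders.
Context (R : realType) (d : nat).
Local Notation T := (even_fset R).
Local Notation TT := (d.-tuple (even_fset R)).
Implicit Types (sigma : seq ('I_d * R * bool)).

Definition cylinder sigma : set TT :=
  [set U : TT | all (fun q => path_of (tnth U q.1.1) q.1.2 == q.2) sigma].

Definition cylinders : set (set TT) :=
  [set A | exists2 sigma, {in sigma, forall q, 0 <= q.1.2 <= 1} & A = cylinder sigma].

Lemma measurable_cylinder sigma : {in sigma, forall q, 0 <= q.1.2 <= 1} ->
  measurable (cylinder sigma).
Proof.
elim: sigma => [|q sigma IH] h.
  by rewrite (_ : cylinder [::] = setT)//; apply/seteqP.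
rewrite (_ : cylinder _ = [set U : TT | path_of (tnth U q.1.1) q.1.2 == q.2] `&` cylinder sigma).
  apply: measurableI; last by apply: IH => x xs; apply: h; rewrite inE xs orbT.
  have q01 : 0 <= q.1.2 <= 1 by apply: h; rewrite inE eqxx.
  have := @measurable_tnth _ T d q.1.1 measurableT _ (measurable_path_of q01).
  rewrite setTI => mq; case: q.2.
    by rewrite (_ : [set U : TT | _] = (tnth (T := T))^~ q.1.1 @^-1` [set V | path_of V q.1.2])//;
      apply/seteqP; split => U /= => [/eqP|->].
  rewrite (_ : [set U : TT | _] = ~` ((tnth (T := T))^~ q.1.1 @^-1` [set V | path_of V q.1.2])).
    exact: measurableC.
  by apply/seteqP; split => U /=; [move=> /eqP -> //|move/negP/negbTE => ->].
by apply/seteqP; split => U; [move=> /andP|move=> /andP].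
Qed.

Lemma measurable_cylindersE : @measurable _ TT = <<s cylinders >>.
Proof.
apply/seteqP; split; last first.
  apply: smallest_sub; first exact: sigma_algebra_measurable.
  by move=> _ [sigma s01 ->]; exact: measurable_cylinder.
apply: smallest_sub; first exact: smallest_sigma_algebra.
move=> A; rewrite -bigcup_seq => -[i _ [B mB <-]].
have : measurable_fun [set: g_sigma_algebraType cylinders]
    (fun U : g_sigma_algebraType cylinders => tnth (U : TT) i).
  apply: (@measurability _ _ _ _ _ _ (evaluation_sets R)) => //.
  move=> _ [_ [t [t01 ->]] <-]; rewrite setTI; apply: sub_sigma_algebra.
  exists [:: (i, t, true)]; first by move=> q; rewrite inE => /eqP ->.
  by apply/seteqP; split => U; rewrite /cylinder /= andbT; [move=> ->|move=> /eqP].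
by move=> /(_ measurableT _ mB).
Qed.

(** Cylinders form a pi-system that generates the product sigma-algebra. *)
Lemma cylinders_determine (mu nu : probability TT R) :
  (forall sigma, {in sigma, forall q, 0 <= q.1.2 <= 1} ->
    mu (cylinder sigma) = nu (cylinder sigma)) ->
  forall A, measurable A -> mu A = nu A.
Proof.
move=> munu; apply: (measure_unique cylinders (fun=> setT)).
- exact: measurable_cylindersE.
- move=> _ _ [s1 h1 ->] [s2 h2 ->]; exists (s1 ++ s2).
    by move=> q; rewrite mem_cat => /orP[/h1|/h2].
  by apply/seteqP; split => U; rewrite /cylinder /= all_cat => /andP.
- by move=> _; exists [::] => //; apply/seteqP.
- by rewrite bigcup_const.
- by move=> _ [sigma s01 ->]; exact: munu.
- by move=> _; rewrite [X in (X < _)%E](probability_setT mu) ltry.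
Qed.

(** The indicator of a cylinder is the product of (1 + (-1)^b (-1)^(position)) / 2
    over its constraints; this is the list of monomials obtained by multiplying out,
    each with its coefficient. *)
Fixpoint expansion sigma : seq (R * seq ('I_d * R)) :=
  if sigma is q :: sigma' then
    [seq (z.1 / 2, z.2) | z <- expansion sigma'] ++
    [seq ((-1) ^+ q.2 * z.1 / 2, q.1 :: z.2) | z <- expansion sigma']
  else [:: (1, [::])].

Lemma expansionE (phi : 'I_d * R -> bool) sigma :
  (all (fun q => phi q.1 == q.2) sigma)%:R =
  \sum_(z <- expansion sigma) z.1 * \prod_(p <- z.2) (-1) ^+ phi p :> R.
Proof.
elim: sigma => [|q sigma IH] /=; first by rewrite big_seq1 big_nil mulr1.
rewrite big_cat !big_map /= -mulnb natrM IH.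
under [X in _ = _ + X]eq_bigr do rewrite big_cons.
rewrite -big_split mulr_sumr; apply: eq_bigr => z _ /=.
by case: (phi q.1) (q.2) => -[]; rewrite /= ?expr0 ?expr1 ?mul1r ?mul0r ?mulN1r ?mulrN ?mulNr; field.
Qed.

Lemma expansion_times sigma z p : z \in expansion sigma -> p \in z.2 ->
  exists2 q, q \in sigma & q.1 = p.
Proof.
elim: sigma z => [|q sigma IH] z /=; first by rewrite inE => /eqP ->.
rewrite mem_cat => /orP[] /mapP[y ys -> /=].
  by move=> /(IH _ ys)[r rs <-]; exists r => //; rewrite inE rs orbT.
rewrite inE => /orP[/eqP ->|/(IH _ ys)[r rs <-]]; first by exists q => //; rewrite inE eqxx.
by exists r => //; rewrite inE rs orbT.
Qed.

End cylinders.

Section finite_sums.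
Context d (S : measurableType d) (R : realType) (P : probability S R).

Lemma integrable_sum_seq (I : eqType) (r : seq I) (F : I -> S -> R) :
  {in r, forall i, P.-integrable setT (EFin \o F i)} ->
  P.-integrable setT (EFin \o (fun x => \sum_(i <- r) F i x)) /\
  \int[P]_x (\sum_(i <- r) F i x) = \sum_(i <- r) \int[P]_x F i x.
Proof.
elim: r => [|i r IH] iF.
  rewrite big_nil (_ : (fun _ => _) = fun=> 0).
    by split; [exact: integrable_cst|exact: Rintegral_cst1].
  by apply/funext => x; rewrite big_nil.
have [ir er] := IH (fun j jr => iF j (mem_behead (s := i :: r) jr)).
have ii := iF i (mem_head _ _).
rewrite (_ : (fun _ => _) = fun x => F i x + \sum_(j <- r) F j x); last first.
  by apply/funext => x; rewrite big_cons.
split; first exact: (integrable_add ii ir).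
by rewrite (RintegralD measurableT ii ir) er big_cons.
Qed.

Lemma Rintegral_indic (A : set S) : measurable A -> \int[P]_x \1_A x = fine (P A).
Proof. by move=> mA; rewrite /Rintegral integral_indic// setIT. Qed.

Lemma Rintegral_fintype (F : finType) (Y : S -> F) (phi : F -> R) :
  (forall y, measurable [set w | Y w = y]) ->
  P.-integrable setT (EFin \o (phi \o Y)) /\
  \int[P]_w phi (Y w) = \sum_y phi y * fine (P [set w | Y w = y]).
Proof.
move=> mY.
have i1 y : P.-integrable setT (EFin \o (fun w => phi y * \1_[set w | Y w = y] w)).
  apply: (@bounded_integrable _ _ _ _ _ `|phi y|).
    by apply: measurable_funM => //; exact: measurable_indic.
  move=> w; rewrite normrM indicE; case: (_ \in _); rewrite ?normr1 ?mulr1//.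
  by rewrite normr0 mulr0.
have E : phi \o Y = fun w => \sum_y phi y * \1_[set w | Y w = y] w.
  apply/funext => w; rewrite /= (bigD1 (Y w))//= indicE mem_set// mulr1 big1 ?addr0//.
  by move=> y yY; rewrite indicE memNset ?mulr0// => /= /esym/eqP; rewrite (negbTE yY).
have [iS eS] := @integrable_sum_seq _ (index_enum F) _ (fun y _ => i1 y).
rewrite -E in iS; split=> //; rewrite -[X in Rintegral _ _ X]/(phi \o Y) E eS.
apply: eq_bigr => y _; rewrite RintegralZl// ?Rintegral_indic//.
apply: (@bounded_integrable _ _ _ _ _ 1); first exact: measurable_indic.
by move=> w; rewrite indicE; case: (_ \in _); rewrite ?normr1 ?normr0.
Qed.

End finite_sums.

(** * Characters of the cube and the transition function *)

Section fourier.
Context (R : realType) (d : nat) (a : 'I_d -> R).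
Implicit Types (S x y z : cube d) (i : 'I_d).

Definition cube_char S x : R := \prod_i (-1) ^+ (S i && x i).

Definition decay S : R := \sum_(i < d) a i *+ S i.

Lemma cube_char_flip S i z : cube_char S (flip i z) = (-1) ^+ S i * cube_char S z.
Proof.
rewrite /cube_char (bigD1 i)//= [in RHS](bigD1 i)//= mulrA; congr (_ * _).
  by rewrite ffunE eqxx; case: (S i); case: (z i) => /=; rewrite ?expr0 ?expr1 ?mulrNN ?mulr1.
by apply: eq_bigr => j /negbTE ji; rewrite ffunE ji.
Qed.

Lemma flip_neq i z : (z == flip i z) = false.
Proof.
by apply/negP => /eqP/ffunP/(_ i); rewrite ffunE eqxx; case: (z i).
Qed.

(** A flip of coordinate i multiplies the character of S by -1 if i belongs to S, so
    each such coordinate contributes -2 a_i to the eigenvalue. *)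
Lemma flip_generator_char S z :
  \sum_y flip_generator a z y * cube_char S y = - (2 * decay S) * cube_char S z.
Proof.
have E y : flip_generator a z y * cube_char S y =
    (if y == z then - (\sum_(i < d) a i) * cube_char S z else 0) +
    \sum_(i < d | y == flip i z) a i * cube_char S (flip i z).
  rewrite /flip_generator; case: eqP => [->|_].
    rewrite [X in _ + X]big_pred0 ?addr0// => i; exact: flip_neq.
  by rewrite add0r mulr_suml; apply: eq_bigr => i /eqP ->.
rewrite (eq_bigr _ (fun y _ => E y)) big_split /= -big_mkcond big_pred1_eq.
rewrite (exchange_big_dep xpredT)//=.
rewrite [X in _ + X](eq_bigr (fun i => a i * (-1) ^+ S i * cube_char S z)); last first.
  by move=> i _; rewrite (big_pred1 (flip i z))// cube_char_flip mulrA.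
rewrite -mulr_suml -mulrDl; congr (_ * _); rewrite /decay mulr_sumr -!sumrN -big_split /=.
apply: eq_bigr => i _; case: (S i); rewrite ?mulr1n ?mulr0n ?expr1 ?expr0; ring.
Qed.

Lemma is_derive_sum_seq (I : Type) (r : seq I) (f : I -> R -> R) (df : I -> R) (t : R) :
  (forall k, is_derive t 1 (f k) (df k)) ->
  is_derive t 1 (fun u => \sum_(k <- r) f k u) (\sum_(k <- r) df k).
Proof.
move=> h; elim: r => [|k r IH].
  rewrite big_nil (_ : (fun _ => _) = cst 0); first exact: is_derive_cst.
  by apply/funext => u; rewrite big_nil.
rewrite big_cons (_ : (fun _ => _) = f k + (fun u => \sum_(k <- r) f k u)).
  exact: is_deriveD.
by apply/funext => u; rewrite big_cons.
Qed.

(** v(t) exp(c t) has zero derivative on the positive half-line and is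
    right-continuous at 0, hence is constant. *)
Lemma linear_ode (c : R) (v : R -> R) :
  (forall t : R, 0 < t -> is_derive t 1 v (- c * v t)) ->
  v h @[h --> 0^'+] --> v 0 ->
  forall t : R, 0 <= t -> v t = v 0 * expR (- c * t).
Proof.
move=> dv v0 t; rewrite le_eqVlt => /predU1P[<-|t0].
  by rewrite mulr0 expR0 mulr1.
pose g u := v u * expR (c * u).
have dexp (u : R) : is_derive u 1 (fun u => expR (c * u)) (c * expR (c * u)).
  have dcu : is_derive u 1 (fun u : R => c * u) c.
    by apply: is_derive_eq (is_deriveZ c (is_derive_id u 1)) _; rewrite /GRing.scale /= mulr1.
  have := @is_derive1_comp _ expR (fun u => c * u) u _ _ (is_derive_expR (c * u)) dcu.
  by rewrite mulrC.
have dg (u : R) : 0 < u -> is_derive u 1 g 0.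
  move=> u0; have := @is_deriveM R _ v (fun u => expR (c * u)) u 1 _ _ (dv u u0) (dexp u).
  by move=> h; apply: is_derive_eq h _; rewrite /GRing.scale /=; ring.
have gcst (s : R) : 0 < s -> s < t -> g s = g t.
  move=> s0 st; have [|u|e _] := @MVT R g (fun=> 0) s t st.
  - by move=> u; rewrite in_itv /= => /andP[su _]; apply: dg; exact: lt_trans su.
  - apply: derivable_within_continuous => x; rewrite in_itv /= => /andP[sx _].
    by have [] := dg x (lt_le_trans s0 sx).
  - by rewrite mul0r => /eqP; rewrite subr_eq0 eq_sym => /eqP.
have g0 : g h @[h --> 0^'+] --> g 0.
  apply: cvgM => //; apply: cvg_at_right_filter.
  have : {for 0, continuous (fun u : R => expR (c * u))}.
    by apply/differentiable_continuous/derivable1_diffP; case: (dexp 0).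
  by [].
have gt : g h @[h --> 0^'+] --> g t.
  apply: cvg_near_cst; near=> h; apply: gcst; near: h.
    exact: nbhs_right_gt.
  exact: nbhs_right_lt.
have := cvg_unique _ g0 gt; rewrite /g mulr0 expR0 mulr1 => ->//.
by rewrite mulNr -mulrA -expRD subrr expR0 mulr1.
Unshelve. all: by end_near. Qed.

Lemma transition_char (p : R -> cube d -> cube d -> R) S x (t : R) :
  transition_function (flip_generator a) p -> 0 <= t ->
  \sum_y p t x y * cube_char S y = expR (- (2 * decay S) * t) * cube_char S x.
Proof.
move=> [p0 pc dp] t0; pose v u := \sum_y p u x y * cube_char S y.
have v0 : v 0 = cube_char S x.
  rewrite /v (bigD1 x)//= p0 eqxx mul1r big1 ?addr0// => y yx.
  by rewrite p0 eq_sym (negbTE yx) mul0r.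
have dv (u : R) : 0 < u -> is_derive u 1 v (- (2 * decay S) * v u).
  move=> u0.
  have dterm y : is_derive u 1 (fun u => p u x y * cube_char S y)
      ((\sum_z p u x z * flip_generator a z y) * cube_char S y).
    have := is_deriveZ (cube_char S y) (dp u x y u0).
    rewrite [X in is_derive _ _ X](_ : _ = fun u => p u x y * cube_char S y).
      by rewrite /GRing.scale /= mulrC.
    by apply/funext => u'; rewrite /GRing.scale /= mulrC.
  apply: is_derive_eq (is_derive_sum_seq (index_enum (cube d)) dterm) _.
  under eq_bigr do rewrite mulr_suml.
  rewrite exchange_big /= /v mulr_sumr; apply: eq_bigr => z _.
  under eq_bigr do rewrite -mulrA.
  by rewrite -mulr_sumr flip_generator_char mulrCA.
have cv : v h @[h --> 0^'+] --> v 0.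
  apply: (@cvg_big R _ +%R 0) => [|y _]; first exact: add_continuous.
  by apply: cvgMl; exact: pc.
by have := linear_ode dv cv t0; rewrite v0 mulrC.
Qed.

End fourier.

(** * Integrals of products of step functions *)

Section sign_integral.
Context (R : realType).
Local Notation leb := (@lebesgue_measure R).
Implicit Types (s : seq R) (t T : R).

Definition step_sign s (u : R) : R := \prod_(t <- s) (-1) ^+ (u <= t)%R.

Definition sign_integral s T : R := \int[leb]_(u in `]0, T]) step_sign s u.

Lemma measurable_step_sign s : measurable_fun [set: measurableTypeR R] (step_sign s).
Proof.
apply: (@measurable_prod _ (measurableTypeR R)) => t _.
apply: (@measurable_sign R _ (measurableTypeR R) (fun u => u <= t)).
by rewrite (_ : [set _ | _] = `]-oo, t]%classic)//; apply/seteqP; split => u /=; rewrite in_itv.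
Qed.

Lemma lebesgue_itv_lty (a b : R) (x y : bool) :
  (leb [set` Interval (BSide x a) (BSide y b)] < +oo)%E.
Proof. by rewrite lebesgue_measure_itv/=; case: ifP => _; rewrite -?EFinB ltry. Qed.

Lemma integrable_step_sign s (a b : R) (x y : bool) :
  leb.-integrable [set` Interval (BSide x a) (BSide y b)] (EFin \o step_sign s).
Proof.
apply: measurable_bounded_integrable => //; first exact: lebesgue_itv_lty.
  by apply: measurable_funTS; exact: measurable_step_sign.
exists 1; split; first exact: num_real.
by move=> z z1 u _ /=; rewrite (le_trans (normr_prod_sign _ _ _))// ltW.
Qed.

Lemma Rintegral_itv_cst (a b : R) (c : R) : a <= b -> \int[leb]_(u in `]a, b]) c = c * (b - a).
Proof.
move=> ab; rewrite Rintegral_cst//; congr (_ * _).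
transitivity (fine (leb `]a, b])) => //; rewrite lebesgue_measure_itv/= lte_fin.
by move: ab; rewrite le_eqVlt => /predU1P[->|->//]; rewrite ltxx subrr.
Qed.

Lemma sign_integral_nil T : 0 <= T -> sign_integral [::] T = T.
Proof.
move=> T0; rewrite /sign_integral (@eq_Rintegral _ _ _ _ _ (fun=> 1)).
  by rewrite Rintegral_itv_cst// mul1r subr0.
by move=> u _; rewrite /step_sign big_nil.
Qed.

(** Beyond the last of the times [s] all the signs are 1. *)
Lemma sign_integral_extend s t T : 0 <= t -> t <= T -> {in s, forall r, r <= t} ->
  sign_integral s T = sign_integral s t + (T - t).
Proof.
move=> t0 tT st; rewrite /sign_integral; apply/eqP; rewrite addrC -subr_eq; apply/eqP.
rewrite Rintegral_itvB; last 3 first.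
- exact: integrable_step_sign.
- by rewrite bnd_simp.
- by rewrite bnd_simp.
rewrite (@eq_Rintegral _ _ _ _ _ (fun=> 1)); first by rewrite Rintegral_itv_cst// mul1r.
move=> u; rewrite inE /= in_itv /= => /andP[tu _].
rewrite /step_sign big_seq big1// => r rs.
by rewrite leNgt (le_lt_trans (st r rs) tu) expr0.
Qed.

Lemma sign_integral_rcons s t : sign_integral (rcons s t) t = - sign_integral s t.
Proof.
rewrite /sign_integral -mulN1r -RintegralZl//; last exact: integrable_step_sign.
apply: eq_Rintegral => u; rewrite inE /= in_itv /= => /andP[_ ut].
by rewrite /step_sign -cats1 big_cat big_seq1 ut expr1 /= mulrC.
Qed.

(** The endpoints, where [eps] and [step_sign] may differ, form a null set. *)
Lemma unif_eps s : \int[@unif R]_u eps s u = sign_integral s 1.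
Proof.
have eps1 (u : R) : `|eps s u| <= 1 by exact: normr_prod_sign.
have meps := measurable_eps s.
have ieps : (@unif R).-integrable setT (EFin \o eps s).
  exact: (bounded_integrable (@unif R) meps eps1).
have ileb : leb.-integrable `[0%R, 1%R] (EFin \o eps s).
  apply: measurable_bounded_integrable => //; first exact: lebesgue_itv_lty.
    exact: measurable_funTS.
  exists 1; split; first exact: num_real.
  by move=> z z1 u _ /=; rewrite (le_trans (eps1 u))// ltW.
(* adding 1 makes the integrand nonnegative, as required by [integral_uniform] *)
have shift : \int[@unif R]_u (eps s u + 1) = \int[leb]_(u in `[0%R, 1%R]) (eps s u + 1).
  rewrite /Rintegral integral_uniform//.
  - by rewrite subr0 invr1 mul1e.
  - by apply/measurable_EFinP/measurable_funD.
  - by move=> u; rewrite lee_fin; have := eps1 u; rewrite ler_norml => /andP[]; lra.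
have i1 : leb.-integrable `[0%R, 1%R] (EFin \o (fun=> 1)).
  apply: measurable_bounded_integrable => //; first exact: lebesgue_itv_lty.
  exists 1; split; first exact: num_real.
  by move=> z z1 u _ /=; rewrite normr1 ltW.
move: shift; rewrite RintegralD//; last exact: integrable_cst.
rewrite Rintegral_cst1 RintegralD// (_ : \int[leb]_(u in `[0%R, 1%R]) 1 = 1); last first.
  rewrite -Rintegral_itv_obnd_cbnd ?Rintegral_itv_cst ?subr0 ?mulr1//.
  by apply: integrableS i1 => //; apply: subset_itvr; rewrite bnd_simp.
move=> /addIr ->.
have inner x : x \in `]0, 1[%classic -> eps s x = step_sign s x.
  by rewrite inE /= in_itv /= => x01; apply: eq_bigr => t _; rewrite /clamp x01.
transitivity (\int[leb]_(u in `]0%R, 1%R[) eps s u).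
  rewrite -Rintegral_itv_obnd_cbnd; last first.
    by apply: integrableS ileb => //; apply: subset_itvr; rewrite bnd_simp.
  rewrite -Rintegral_itv_bndo_bndc//.
  by apply: integrableS ileb => // x /=; rewrite !in_itv /= => /andP[? ?]; rewrite !ltW.
transitivity (\int[leb]_(u in `]0%R, 1%R[) step_sign s u).
  by apply: eq_Rintegral => u; exact: inner.
rewrite Rintegral_itv_bndo_bndc//; exact: integrable_step_sign.
Qed.

End sign_integral.

(** * Moments of the pinned walk *)

Section walk.
Context (R : realType) (d : nat) (a : 'I_d -> R) (disp : measure_display)
  (Omega : measurableType disp) (P : probability Omega R) (X : R -> Omega -> cube d).
Context (walk : random_walk a P X).
Implicit Types (S x y z : cube d) (i : 'I_d) (tau : seq ('I_d * R)) (T : R).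

Lemma measurable_walk (t : R) x : 0 <= t <= 1 -> measurable [set w | X t w = x].
Proof. by case: walk => -[mX _] _; exact: mX. Qed.

Lemma measurable_walk_pred (t : R) (b : cube d -> bool) : 0 <= t <= 1 ->
  measurable [set w | b (X t w)].
Proof.
move=> t01; rewrite (_ : [set w | _] =
    \big[setU/set0]_(x <- index_enum (cube d) | b x) [set w | X t w = x]).
  by apply: bigsetU_measurable => x _; exact: measurable_walk.
apply/seteqP; split => w /=.
  by move=> bw; rewrite (bigD1 (X t w))//=; left.
by rewrite -bigcup_seq_cond => -[x /= /andP[_ bx] ->].
Qed.

Lemma measurable_history n (t : nat -> R) (x : nat -> cube d) :
  (forall k, (k <= n)%N -> 0 <= t k <= 1) ->
  measurable [set w | forall k, (k <= n)%N -> X (t k) w = x k].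
Proof.
move=> t01; rewrite (_ : [set w | _] =
    \bigcap_(k in [set k | (k <= n)%N]) [set w | X (t k) w = x k]).
  apply: bigcap_measurable; first by exists 0%N.
  by move=> k /= kn; exact/measurable_walk/t01.
by apply/seteqP; split => w h k /= kn; exact: h.
Qed.

(** The Markov property only speaks of events, so both sides are expanded over the
    finitely many values of the history; the sum over the last position is then
    evaluated by [transition_char]. *)
Lemma markov_char n (t : nat -> R) (h : {ffun 'I_n.+1 -> cube d} -> R) S :
  0 <= t 0%N -> (forall k, (k <= n)%N -> t k <= t k.+1) -> t n.+1 <= 1 ->
  let Y w : {ffun 'I_n.+1 -> cube d} := [ffun k : 'I_n.+1 => X (t k) w] in
  \int[P]_w (h (Y w) * cube_char R S (X (t n.+1) w)) =
  expR (- (2 * decay a S) * (t n.+1 - t n)) *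
  \int[P]_w (h (Y w) * cube_char R S (X (t n) w)).
Proof.
move=> t0 tS t1 Y.
have mono j k : (j <= k)%N -> (k <= n.+1)%N -> t j <= t k.
  elim: k => [|k IH]; first by rewrite leqn0 => /eqP ->.
  rewrite leq_eqVlt => /predU1P[->//|jk] kn.
  by rewrite (le_trans (IH jk (ltnW kn)))// tS.
have t_ge0 k : (k <= n.+1)%N -> 0 <= t k.
  by move=> kn; exact: le_trans t0 (mono _ _ (leq0n k) kn).
have t_le1 k : (k <= n.+1)%N -> t k <= 1.
  by move=> kn; exact: le_trans (mono _ _ kn (leqnn _)) t1.
have t01 k : (k <= n.+1)%N -> 0 <= t k <= 1 by move=> kn; rewrite t_ge0 ?t_le1.
case: walk => -[_ [p pq markov]] _.
pose ext (y : {ffun 'I_n.+1 -> cube d}) z k := if (k <= n)%N then y (inord k) else z.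
have YE (y : {ffun 'I_n.+1 -> cube d}) z : [set w | Y w = y] = [set w | forall k, (k <= n)%N -> X (t k) w = ext y z k].
  apply/seteqP; split => w /=.
    move=> <- k kn; rewrite /ext kn ffunE inordK//.
  move=> h'; apply/ffunP => k; rewrite ffunE h'; last by rewrite -ltnS.
  by rewrite /ext -ltnS ltn_ord inord_val.
have YXE (y : {ffun 'I_n.+1 -> cube d}) z : [set w | (Y w, X (t n.+1) w) = (y, z)] =
    [set w | forall k, (k <= n.+1)%N -> X (t k) w = ext y z k].
  apply/seteqP; split => w.
    move=> -[yE zE] k; rewrite leq_eqVlt => /predU1P[->|kn].
      by rewrite /ext ltnn.
    by have : [set w | Y w = y] w by []; rewrite (YE _ z); apply.
  move=> /= h'; congr pair; last by rewrite h'// /ext ltnn.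
  suff : [set w | Y w = y] w by [].
  by rewrite (YE _ z) => k kn; apply: h'; exact: leqW.
have mY (y : {ffun 'I_n.+1 -> cube d}) : measurable [set w | Y w = y].
  by rewrite (YE _ (origin d)); apply: measurable_history => k kn; exact/t01/leqW.
have mYX yz : measurable [set w | (Y w, X (t n.+1) w) = yz].
  by case: yz => y z; rewrite YXE; exact: measurable_history.
rewrite (Rintegral_fintype P (fun yz : {ffun 'I_n.+1 -> cube d} * cube d => h yz.1 * cube_char R S yz.2) mYX).2.
have -> : (fun w => h (Y w) * cube_char R S (X (t n) w)) =
    (fun w => (fun (y : {ffun 'I_n.+1 -> cube d}) => h y * cube_char R S (y ord_max)) (Y w)).
  by apply/funext => w; rewrite /= ffunE.
rewrite (Rintegral_fintype P (fun (y : {ffun 'I_n.+1 -> cube d}) => h y * cube_char R S (y ord_max)) mY).2.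
transitivity (\sum_(y : {ffun 'I_n.+1 -> cube d}) \sum_z h y * cube_char R S z *
    fine (P [set w | (Y w, X (t n.+1) w) = (y, z)])).
  by rewrite pair_bigA; apply: eq_bigr => -[].
rewrite mulr_sumr.
apply: eq_bigr => y _.
have PYX z : fine (P [set w | (Y w, X (t n.+1) w) = (y, z)]) =
    fine (P [set w | Y w = y]) * p (t n.+1 - t n) (y ord_max) z.
  rewrite YXE markov// -YE fineM//; last exact: fin_num_measure.
  congr (_ * p _ _ _); rewrite /ext ?leqnn ?ltnn//.
  by congr (y _); apply/val_inj; rewrite /= inordK.
under eq_bigr do rewrite PYX.
transitivity (h y * fine (P [set w | Y w = y]) *
    \sum_z p (t n.+1 - t n) (y ord_max) z * cube_char R S z).
  by rewrite mulr_sumr; apply: eq_bigr => z _; ring.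
by rewrite (transition_char _ _ pq) ?subr_ge0 ?tS//; ring.
Qed.

Definition walk_sign tau w : R := \prod_(p <- tau) (-1) ^+ X p.2 w p.1.

Definition starts w : R := (X 0 w == origin d)%:R.

Lemma markov_sign tau S T : path <=%R 0 [seq p.2 | p <- tau] ->
  last 0 [seq p.2 | p <- tau] <= T -> T <= 1 ->
  \int[P]_w (starts w * walk_sign tau w * cube_char R S (X T w)) =
  expR (- (2 * decay a S) * (T - last 0 [seq p.2 | p <- tau])) *
  \int[P]_w (starts w * walk_sign tau w *
    cube_char R S (X (last 0 [seq p.2 | p <- tau]) w)).
Proof.
set s := [seq p.2 | p <- tau] => path_s last_s T1.
pose n := size tau; have sn : size s = n by rewrite size_map.
pose t k := nth T (0 :: rcons s T) k.
have tn : t n = last 0 s.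
  by rewrite /t -rcons_cons nth_rcons /= sn ltnSn -sn -[size s]/(size (0 :: s)).-1 nth_last.
have tT : t n.+1 = T by rewrite /t /= nth_rcons sn ltnn eqxx.
pose h (y : {ffun 'I_n.+1 -> cube d}) : R := (y ord0 == origin d)%:R *
  \prod_(k < n) (-1) ^+ y (lift ord0 k) (tnth (in_tuple tau) k).1.
have hE w : h [ffun k : 'I_n.+1 => X (t k) w] = starts w * walk_sign tau w.
  rewrite /h /starts ffunE; congr (_ * _); rewrite /walk_sign big_tnth.
  apply: eq_bigr => k _; rewrite ffunE.
  suff -> : t (lift ord0 k) = (tnth (in_tuple tau) k).2 by [].
  rewrite /t /= nth_rcons sn ltn_ord (nth_map (tnth (in_tuple tau) k)) ?ltn_ord//.
  by rewrite [in RHS](tnth_nth (tnth (in_tuple tau) k)).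
have := @markov_char n t h S; rewrite tn tT => markov.
have E T' : \int[P]_w (starts w * walk_sign tau w * cube_char R S (X T' w)) =
    \int[P]_w (h [ffun k : 'I_n.+1 => X (t k) w] * cube_char R S (X T' w)).
  by apply: eq_Rintegral => w _; rewrite hE.
rewrite !E; apply: markov => // k kn.
have path_sT : path <=%R 0 (rcons s T) by rewrite rcons_path path_s.
by have /(pathP T)/(_ k) := path_sT; apply; rewrite size_rcons sn ltnS.
Qed.

Lemma times_rcons i tau p : times i (rcons tau p) =
  if p.1 == i then rcons (times i tau) p.2 else times i tau.
Proof. by rewrite /times filter_rcons; case: ifP => // _; rewrite map_rcons. Qed.

(** The last observation of coordinate j multiplies the character of S by a sign of
    coordinate j, which amounts to exchanging S with [flip j S]; earlier
    observations are then handled by induction.  On the side of the integrals this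
    changes the sign of the step function of coordinate j before that time. *)
Lemma walk_moment tau S T : path <=%R 0 [seq p.2 | p <- tau] ->
  last 0 [seq p.2 | p <- tau] <= T -> T <= 1 ->
  \int[P]_w (starts w * walk_sign tau w * cube_char R S (X T w)) =
  \int[P]_w starts w *
  \prod_i expR (- a i * (T - (-1) ^+ S i * sign_integral (times i tau) T)).
Proof.
elim/last_ind: tau S T => [|tau p IH] S T path_tau lastT T1.
  rewrite markov_sign//= subr0.
  under eq_Rintegral => w _.
    rewrite /walk_sign big_nil mulr1 (_ : _ * _ = starts w); last first.
      rewrite /starts; case: eqP => [->|]; rewrite ?mul0r ?mul1r//.
      by rewrite /cube_char big1// => i _; rewrite ffunE andbF.
    over.
  rewrite mulrC; congr (_ * _); rewrite -expR_sum; congr expR.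
  rewrite /decay mulr_sumr -sumrN mulr_suml; apply: eq_bigr => i _.
  by rewrite sign_integral_nil//; case: (S i); rewrite ?mulr1n ?mulr0n ?expr1 ?expr0; ring.
have := path_tau; rewrite map_rcons rcons_path => /andP[path_tau' last_p].
have p2T : p.2 <= T by move: lastT; rewrite map_rcons last_rcons.
have p0 : 0 <= p.2.
  apply: le_trans last_p; have /allP ge0 := order_path_min le_trans path_tau'.
  by have := mem_last 0 [seq q.2 | q <- tau]; rewrite inE => /orP[/eqP ->|/ge0].
have tau_p : {in [seq q.2 | q <- tau], forall r, r <= p.2}.
  move=> r rtau; apply: le_trans last_p.
  have /= := path_tau'; rewrite -[path _ _ _]/(sorted <=%R (0 :: _)).
  move=> /(sorted_leq_nth le_trans lexx 0) mono.
  have rs : r \in 0 :: [seq q.2 | q <- tau] by rewrite inE rtau orbT.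
  rewrite -[leLHS](nth_index 0 rs) -[leRHS]/(last 0 (0 :: _)) -nth_last.
  by apply: mono; rewrite ?inE ?index_mem// -ltnS prednK// index_mem.
rewrite markov_sign// map_rcons last_rcons.
have -> : \int[P]_w (starts w * walk_sign (rcons tau p) w * cube_char R S (X p.2 w)) =
    \int[P]_w (starts w * walk_sign tau w * cube_char R (flip p.1 S) (X p.2 w)).
  apply: eq_Rintegral => w _; rewrite /walk_sign -cats1 big_cat big_seq1 /=.
  have charC (y z : cube d) : cube_char R y z = cube_char R z y.
    by apply: eq_bigr => i _; rewrite andbC.
  by rewrite [cube_char R (flip _ _) _]charC cube_char_flip charC !mulrA.
rewrite IH// ?(le_trans p2T)// mulrCA; congr (_ * _).
rewrite /decay mulr_sumr -sumrN mulr_suml expR_sum -big_split /=.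
apply: eq_bigr => i _; rewrite -expRD; congr expR.
rewrite times_rcons ffunE eq_sym.
have times_p : {in times i tau, forall r, r <= p.2}.
  by move=> r /mapP[q]; rewrite mem_filter => /andP[_ qtau] ->; apply/tau_p/map_f.
case: ifP => _.
  rewrite (sign_integral_extend p0 p2T); last first.
    by move=> r; rewrite mem_rcons inE => /orP[/eqP ->//|/times_p].
  rewrite sign_integral_rcons.
  by case: (S i); rewrite ?mulr1n ?mulr0n ?expr1 ?expr0; ring.
rewrite (sign_integral_extend p0 p2T times_p).
by case: (S i); rewrite ?mulr1n ?mulr0n ?expr1 ?expr0; ring.
Qed.

(** Fourier inversion on the cube, for the indicator of the origin *)
Lemma cube_char_sum x : \sum_S cube_char R S x = 2 ^+ d * (x == origin d)%:R.
Proof.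
rewrite /cube_char -(bigA_distr_bigA (fun i (b : bool) => (-1) ^+ (b && x i))) /=.
under eq_bigr do rewrite big_bool /=.
have [->|/eqP xn0] := eqVneq x (origin d).
  rewrite mulr1 (eq_bigr (fun=> 2)); first by rewrite prodr_const card_ord.
  by move=> i _; rewrite ffunE.
have [i xi] : exists i, x i.
  apply: contrapT => /forallNP xF; apply: xn0; apply/ffunP => i; rewrite ffunE.
  exact/negP/xF.
by rewrite mulr0 (bigD1 i)//= xi expr1 expr0 addNr mul0r.
Qed.

Definition returns w : R := (X 1 w == origin d)%:R.

(** Averaging the final character over S averages, in each coordinate, the
    exponentials of a c and - a c.  Observation times in arbitrary order reduce to
    sorted ones. *)
Lemma bridge_sign_moment tau : {in tau, forall p, 0 <= p.2 <= 1} ->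
  \int[P]_w (starts w * returns w * walk_sign tau w) =
  \int[P]_w starts w *
  \prod_i (expR (- a i) * coshR (a i * sign_integral (times i tau) 1)).
Proof.
pose srt := sort (fun p q : 'I_d * R => p.2 <= q.2) tau.
have tot : total (fun p q : 'I_d * R => p.2 <= q.2) by move=> p q; exact: le_total.
have perm_tau : perm_eq srt tau by rewrite perm_sort.
move=> tau01; have srt01 : {in srt, forall p, 0 <= p.2 <= 1}.
  by move=> p; rewrite (perm_mem perm_tau); exact: tau01.
have path_srt : path <=%R 0 [seq p.2 | p <- srt].
  rewrite path_min_sorted.
    by rewrite sorted_map; exact: sort_sorted.
  by apply/allP => r /mapP[p /srt01/andP[p0 _] ->].
have last_srt : last 0 [seq p.2 | p <- srt] <= 1.
  have := mem_last 0 [seq p.2 | p <- srt]; rewrite inE => /orP[/eqP -> //|].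
  by move=> /mapP[p /srt01/andP[_ p1] ->].
have signE w : walk_sign tau w = walk_sign srt w.
  by rewrite /walk_sign (perm_big _ perm_tau).
have intE i : sign_integral (times i tau) 1 = sign_integral (times i srt) 1.
  apply: eq_Rintegral => u _; apply: perm_big; rewrite perm_sym.
  by apply: perm_map; exact: perm_filter.
have E w : starts w * returns w * walk_sign tau w =
    2 ^- d * \sum_S (starts w * walk_sign srt w * cube_char R S (X 1 w)).
  rewrite signE -mulr_sumr cube_char_sum -/(returns w) mulrCA mulKf.
    by rewrite mulrAC.
  by rewrite expf_neq0// pnatr_eq0.
rewrite (eq_Rintegral _ (fun w _ => E w)).
have mstarts : measurable_fun setT starts.
  rewrite (_ : starts = fun w => if X 0 w == origin d then 1 else 0); last first.
    by apply/funext => w; rewrite /starts; case: eqP.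
  apply: measurable_fun_ifT => //; apply: (measurable_fun_bool true); rewrite setTI.
  by apply: (measurable_walk_pred (fun x => x == origin d)); rewrite lexx ler01.
have msign (t : R) i : 0 <= t <= 1 -> measurable_fun setT (fun w => (-1) ^+ X t w i : R).
  by move=> t01; apply: measurable_sign; exact: (measurable_walk_pred (fun x => x i)).
have i1 S : P.-integrable setT
    (EFin \o (fun w => starts w * walk_sign srt w * cube_char R S (X 1 w))).
  apply: (@bounded_integrable _ _ _ _ _ 1).
    apply: measurable_funM; first apply: measurable_funM => //.
      by apply: measurable_prod => p /srt01; exact: msign.
    apply: measurable_prod => i _.
    apply: measurable_sign; apply: (measurable_walk_pred (fun x => S i && x i)).
    by rewrite ler01 lexx.
  move=> w; rewrite !normrM; apply: mulr_ile1 => //; last exact: normr_prod_sign.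
  apply: mulr_ile1 => //; last exact: normr_prod_sign.
  by rewrite /starts normr_nat lern1 leq_b1.
have [iS eS] := integrable_sum_seq (r := index_enum (cube d)) (fun S _ => i1 S).
rewrite RintegralZl// eS.
transitivity (2 ^- d * \sum_(S : cube d) (\int[P]_w starts w *
    \prod_i expR (- a i * (1 - (-1) ^+ S i * sign_integral (times i srt) 1)))).
  by congr (_ * _); apply: eq_bigr => S _; exact: walk_moment.
rewrite -mulr_sumr mulrCA; congr (_ * _).
rewrite -(bigA_distr_bigA (fun i (b : bool) => expR (- a i *
  (1 - (-1) ^+ b * sign_integral (times i srt) 1)))) /=.
rewrite (eq_bigr (fun i => 2 * (expR (- a i) * coshR (a i * sign_integral (times i tau) 1)))).
  by rewrite big_split /= prodr_const card_ord mulKf// expf_neq0// pnatr_eq0.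
move=> i _; rewrite big_bool /= expr1 expr0 /coshR intE.
set I := sign_integral _ _.
have -> : - a i * (1 - -1 * I) = - a i + - (a i * I) by ring.
have -> : - a i * (1 - 1 * I) = - a i + a i * I by ring.
by rewrite !expRD; field.
Qed.

End walk.

(** * Jumps of paths with values in {0,1} *)

Section cadlag_paths.
Context (R : realType).
Implicit Types (t s : R) (x : R -> bool).

(** Look at the supremum of the times up to which [Q] holds throughout: left limits
    show that it is attained, and extension to the right that it is 1. *)
Lemma unit_interval_induction (Q : R -> Prop) : Q 0 ->
  (forall t, 0 <= t < 1 -> Q t -> exists2 e, 0 < e & forall s, t < s < t + e -> Q s) ->
  (forall t, 0 < t <= 1 -> (forall s, 0 <= s < t -> Q s) -> Q t) ->
  forall t, 0 <= t <= 1 -> Q t.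
Proof.
move=> Q0 Qr Ql; pose A := [set t : R | 0 <= t <= 1 /\ forall s, 0 <= s <= t -> Q s].
have A0 : A 0.
  split=> [|s]; first by rewrite lexx ler01.
  by rewrite -eq_le => /eqP <-.
have supA : has_sup A by split; [exists 0|exists 1 => t [/andP[]]].
have c0 : 0 <= sup A by apply: (ub_le_sup supA.2); exact: A0.
have c1 : sup A <= 1 by apply: ge_sup => [|t [/andP[]]]; first by exists 0.
have below s : 0 <= s < sup A -> Q s.
  move=> /andP[s0 sc]; have [t [_ tQ] st] := sup_gt (ex_intro _ _ A0) sc.
  by apply: tQ; rewrite s0 ltW.
have Qc : Q (sup A).
  move: c0; rewrite le_eqVlt => /predU1P[<-//|c0].
  by apply: Ql => //; rewrite c0.
suff cE : sup A = 1.
  move=> t /andP[t0]; rewrite le_eqVlt => /predU1P[->|t1]; first by rewrite -cE.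
  by apply: below; rewrite t0 cE.
apply/eqP; rewrite eq_le c1 leNgt; apply/negP => clt1.
have [e e0 Qe] := Qr _ (introT andP (conj c0 clt1)) Qc.
pose t := Num.min 1 (sup A + e / 2).
have ct : sup A < t by rewrite lt_min clt1 ltrDl divr_gt0.
have tce : t < sup A + e by rewrite gt_min; apply/orP; right; lra.
have : A t.
  split; first by rewrite (le_trans c0 (ltW ct)) ge_min lexx.
  move=> s /andP[s0 st]; have [sc|sc|->//] := ltgtP s (sup A).
    by apply: below; rewrite s0.
  by apply: Qe; rewrite sc (le_lt_trans st).
by move=> /(ub_le_sup supA.2); rewrite leNgt ct.
Qed.

Lemma cvg_bool (F : set_system R) (FF : Filter F) x (b : bool) :
  x u @[u --> F] --> b <-> \forall u \near F, x u = b.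
Proof.
split=> [xb|xb].
  by have /(_ [set b]) := xb; apply; exact: discrete_set1.
apply: cvg_near_cst; exact: xb.
Qed.

Lemma at_right_ball t (Q : R -> Prop) : (\forall u \near t^'+, Q u) ->
  exists2 e, 0 < e & forall u, t < u < t + e -> Q u.
Proof.
move=> [e /= e0 Qe]; exists e => // u /andP[tu ue].
by apply: Qe => //=; rewrite ltr0_norm; lra.
Qed.

Lemma at_left_ball t (Q : R -> Prop) : (\forall u \near t^'-, Q u) ->
  exists2 e, 0 < e & forall u, t - e < u < t -> Q u.
Proof.
move=> [e /= e0 Qe]; exists e => // u /andP[tu ue].
by apply: Qe => //=; rewrite gtr0_norm; lra.
Qed.

Lemma constant_no_jump x (l r : R) (b : bool) s :
  (forall u, l < u < r -> x u = b) -> l < s < r -> ~ jump_times x s.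
Proof.
move=> xb /andP[ls sr] [_]; apply; apply/cvg_bool; near=> u.
rewrite !xb ?ls//; apply/andP; split; first by near: u; exact: nbhs_left_gt.
by apply: lt_trans sr; near: u; exact: nbhs_left_lt.
Unshelve. all: by end_near. Qed.

(** Finiteness of the set of jumps and the parity formula are proved together by
    induction along the unit interval: one-sided limits in a discrete space make the
    path constant on each side of a time, so a time adds at most one jump. *)
Lemma jump_count x : cadlag x -> x 0 = false -> forall t, 0 <= t <= 1 ->
  exists2 V : {fset R}, forall s, s \in V <-> s <= t /\ jump_times x s &
    x t = odd #|` V|%fset.
Proof.
move=> [xr xl] x0; apply: unit_interval_induction.
- exists fset0; last by rewrite cardfs0.
  by move=> s; split; rewrite inE // => -[s0 [/andP[]]]; rewrite ltNge s0.
- move=> t t01 [V VE Vt]; have /cvg_bool/at_right_ball[e e0 xe] := xr t t01.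
  exists e => // s /andP[ts se]; exists V; last by rewrite xe ?ts.
  move=> r; rewrite VE; split=> -[rt jr]; split=> //.
    by rewrite (le_trans rt)// ltW.
  rewrite leNgt; apply/negP => tr; apply: constant_no_jump xe _ jr.
  by rewrite tr (le_lt_trans rt).
move=> t t01 IH; have /andP[t0 t1] := t01.
have /cvg_ex[b xb] := xl t t01; have /cvg_bool/at_left_ball[e e0 xe] := xb.
pose s := Num.max 0 (t - e / 2).
have s_ge0 : 0 <= s by rewrite le_max lexx.
have st : s < t by rewrite gt_max t0; lra.
have es : t - e < s by rewrite lt_max; apply/orP; right; lra.
have [V VE Vs] := IH s (introT andP (conj s_ge0 st)).
have bV : b = odd #|` V|%fset by rewrite -Vs xe// es.
have jump_lt r : r < t -> jump_times x r -> r <= s.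
  move=> rt jr; rewrite leNgt; apply/negP => sr; apply: constant_no_jump xe _ jr.
  by rewrite rt (lt_trans es).
have [xtb|xtb] := eqVneq (x t) b.
  exists V; last by rewrite xtb.
  move=> r; rewrite VE; split=> -[rs jr]; split=> //.
    by rewrite (le_trans rs)// ltW.
  apply: jump_lt => //; rewrite lt_neqAle rs andbT; apply: contraPN jr => /eqP ->.
  by move=> [_]; apply; rewrite xtb.
exists (t |` V)%fset.
  move=> r; rewrite !inE; split.
    move=> /orP[/eqP ->|/VE[rs jr]]; last by rewrite (le_trans rs)// ltW.
    split=> //; split=> // xt; have /cvg_bool h1 := xt; have /cvg_bool h2 := xb.
    have [u []] := @filter_ex _ _ (at_left_proper_filter t) _ (filterI h1 h2).
    by move=> -> E; rewrite E eqxx in xtb.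
  move=> [rt jr]; have [->//|rnt] := eqVneq r t.
  by apply/VE; split=> //; apply: jump_lt => //; rewrite lt_neqAle rnt.
have tV : t \notin V by apply/negP => /VE[]; rewrite leNgt st.
by rewrite cardfsU1 tV /= -bV; move: xtb; case: (x t); case: b {xb xe bV}.
Qed.

Lemma jump_times_path_of x (U : {fset R}) : cadlag x -> x 0 = false ->
  jump_times x = [set t | t \in U] -> forall t, 0 <= t <= 1 -> path_of U t = x t.
Proof.
move=> cx x0 xU t t01; have [V VE ->] := jump_count cx x0 t01.
rewrite /path_of; congr (odd #|` _|%fset); apply/fsetP => s; rewrite !inE.
apply/andP/idP => [[sU st]|/VE[-> js]].
  by apply/VE; split=> //; rewrite xU.
by split=> //; move: js; rewrite xU.
Qed.

Lemma jump_times_even_fset x : cadlag x -> x 0 = false -> x 1 = false ->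
  ~ jump_times x 1 ->
  exists U : even_fset R, jump_times x = [set t | t \in even_fset_val U].
Proof.
move=> cx x0 x1 j1; have [|V VE V1] := jump_count cx x0 (t := 1).
  by rewrite ler01 lexx.
have jV : jump_times x = [set t | t \in V].
  apply/seteqP; split => t /=; last by move=> /VE[].
  by move=> jt; apply/VE; split=> //; case: jt => /andP[].
have Vev : even_in_unit_interval V.
  rewrite /even_in_unit_interval -V1 x1 andbT; apply/allP => t tV.
  have [_ jt] := (VE t).1 tV; have [/andP[-> t1] _] := jt.
  rewrite lt_neqAle t1 andbT; apply/eqP => tE; apply: j1; by rewrite -tE.
by exists (EvenFset Vev).
Qed.

End cadlag_paths.

(** * The law of the jump sets of a pinned walk *)

Section bridge_identification.
Context (R : realType) (d : nat) (a : 'I_d -> R) (disp : measure_display)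
  (Omega : measurableType disp) (P : probability Omega R) (X : R -> Omega -> cube d).
Context (walk : random_walk a P X).
Local Notation TT := (d.-tuple (even_fset R)).

Definition pinned : set Omega := [set w | X 0 w = origin d /\ X 1 w = origin d].

Definition encoded_in (A : set TT) : set Omega := [set w | exists2 U, A U &
  forall i, jump_times (fun t => X t w i) = [set t | t \in even_fset_val (tnth U i)]].

Definition walk_cylinder (sigma : seq ('I_d * R * bool)) : set Omega :=
  [set w | all (fun q => X q.1.2 w q.1.1 == q.2) sigma].

Lemma measurable_pinned : measurable pinned.
Proof.
by apply: measurableI; apply: (measurable_walk walk); rewrite ?lexx ?ler01.
Qed.

Lemma measurable_walk_cylinder (sigma : seq ('I_d * R * bool)) : {in sigma, forall q, 0 <= q.1.2 <= 1} ->
  measurable (walk_cylinder sigma).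
Proof.
elim: sigma => [|q sigma IH] h.
  by rewrite (_ : walk_cylinder [::] = setT)//; apply/seteqP.
rewrite (_ : walk_cylinder _ =
    [set w | X q.1.2 w q.1.1 == q.2] `&` walk_cylinder sigma).
  apply: measurableI; last by apply: IH => x xs; apply: h; rewrite inE xs orbT.
  apply: (measurable_walk_pred walk (fun x : cube d => x q.1.1 == q.2)).
  by apply: h; rewrite inE eqxx.
by apply/seteqP; split => w; [move=> /andP|move=> /andP].
Qed.

(** A sequence of times before 1 that increases to 1; along it the left limit at 1
    becomes a countable, hence measurable, condition. *)
Definition last_times (n : nat) : R := 1 - n.+1%:R^-1.

Lemma last_times_itv n : 0 <= last_times n <= 1.
Proof. by rewrite /last_times subr_ge0 invf_le1// ler1n /= gerBl. Qed.

Lemma last_times_near (b : R) : b < 1 -> \forall n \near \oo, b < last_times n < 1.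
Proof.
rewrite -subr_gt0 => b1; near=> n; rewrite /last_times gtrBl invr_gt0 ltr0n andbT.
rewrite ltrBrDr addrC -ltrBrDr; near: n.
exact: (near_infty_natSinv_lt (PosNum b1)).
Unshelve. all: by end_near. Qed.

Lemma no_jump_at_1 w i : cadlag (fun t => X t w i) -> X 1 w i = false ->
  ~ jump_times (fun t => X t w i) 1 <-> \forall n \near \oo, X (last_times n) w i = false.
Proof.
move=> [_ cl] X1.
have /cvg_ex[b Xb] : cvg (X u w i @[u --> 1^'-]) by apply: cl; rewrite ltr01 lexx.
have /cvg_bool/at_left_ball[e e0 Xe] := Xb.
have near_b : \forall n \near \oo, X (last_times n) w i = b.
  have : 1 - e < 1 by rewrite gtrBl.
  by move=> /last_times_near; apply: filterS => n; exact: Xe.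
split=> [nj|nF].
  suff bF : b = false by rewrite -bF.
  rewrite -X1; apply: contrapT => bX; apply: nj; split; first by rewrite ltr01 lexx.
  move=> /cvg_bool h1; have /cvg_bool h2 := Xb; apply: bX.
  by have [u [<- <-]] := @filter_ex _ _ (at_left_proper_filter 1) _ (filterI h1 h2).
move=> [_]; apply; rewrite X1.
suff <- : b = false by [].
by have [n [<- <-]] := @filter_ex _ _ _ _ (filterI near_b nF).
Qed.

(** A pinned path is encoded by even sets inside the open unit interval exactly when
    no coordinate jumps at time 1. *)
Lemma pinned_encoded : pinned `&` encoded_in setT =
  pinned `&` \bigcup_N \bigcap_(n in [set n | (N <= n)%N]) [set w | X (last_times n) w = origin d].
Proof.
have [_ cX] := walk.
apply/seteqP; split => w [[X0 X1]].
  move=> [U _ XU]; split=> //.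
  have : \forall n \near \oo, forall i, X (last_times n) w i = false.
    apply: filter_forall => i; apply/no_jump_at_1 => //; first by rewrite X1 ffunE.
    rewrite XU /= => U1; have /andP[/allP/(_ _ U1)] := even_fset_valP (tnth U i).
    by rewrite ltxx andbF.
  move=> [N _ XN]; exists N => // n /= Nn; apply/ffunP => i; rewrite ffunE; exact: XN.
move=> [N _ XN]; split=> //.
have /choice[U UE] : forall i, exists U : even_fset R,
    jump_times (fun t => X t w i) = [set t | t \in even_fset_val U].
  move=> i; apply: jump_times_even_fset; rewrite ?X0 ?X1 ?ffunE//.
  apply/no_jump_at_1 => //; first by rewrite X1 ffunE.
  by exists N => // n /= Nn; rewrite (XN n Nn) ffunE.
by exists [tuple U i | i < d] => // i; rewrite UE tnth_mktuple.
Qed.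

Lemma measurable_pinned_encoded : measurable (pinned `&` encoded_in setT).
Proof.
rewrite pinned_encoded; apply: measurableI; first exact: measurable_pinned.
apply: bigcup_measurable => N _; apply: bigcap_measurable; first by exists N => /=.
by move=> n _; apply: (measurable_walk walk); exact: last_times_itv.
Qed.

Lemma pinned_encoded_cylinder (sigma : seq ('I_d * R * bool)) : {in sigma, forall q, 0 <= q.1.2 <= 1} ->
  pinned `&` encoded_in (cylinder sigma) =
  pinned `&` encoded_in setT `&` walk_cylinder sigma.
Proof.
have [_ cX] := walk => s01.
have E w U : X 0 w = origin d -> (forall i, jump_times (fun t => X t w i) =
    [set t | t \in even_fset_val (tnth U i)]) -> walk_cylinder sigma w <-> cylinder sigma U.
  move=> X0 XU; rewrite /walk_cylinder /cylinder /=.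
  suff -> : all (fun q => X q.1.2 w q.1.1 == q.2) sigma =
    all (fun q => path_of (tnth U q.1.1) q.1.2 == q.2) sigma by [].
  apply: eq_in_all => q /s01 q01.
  rewrite (jump_times_path_of (x := fun t => X t w q.1.1))//.
  by rewrite X0 ffunE.
apply/seteqP; split => w.
  move=> [[X0 X1] [U AU XU]]; split; last exact/(E _ _ X0 XU).
  by split=> //; exists U.
move=> [[[X0 X1] [U _ XU]] Cw]; split=> //; exists U => //; exact/(E _ _ X0 XU).
Qed.

(** Both the indicator of the cylinder and that of being pinned are expanded, and
    [bridge_sign_moment] evaluates each term; the probability of being pinned is the
    term without observation times. *)
Lemma pinned_cylinder_prob (sigma : seq ('I_d * R * bool)) : {in sigma, forall q, 0 <= q.1.2 <= 1} ->
  fine (P (pinned `&` walk_cylinder sigma)) = fine (P pinned) *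
  \sum_(z <- expansion sigma) z.1 *
    \prod_i (coshR (a i * sign_integral (times i z.2) 1) / coshR (a i)).
Proof.
move=> s01.
have z01 z : z \in expansion sigma -> {in z.2, forall p, 0 <= p.2 <= 1}.
  by move=> zs p pz; have [q qs <-] := expansion_times zs pz; exact: s01.
have startsE w : starts X w * returns X w = \1_pinned w.
  rewrite indicE /starts /returns -natrM mulnb; congr ((nat_of_bool _)%:R).
  apply/idP/idP => [/andP[/eqP X0 /eqP X1]|]; first by rewrite inE.
  by rewrite inE => -[-> ->]; rewrite !eqxx.
have mpinned : measurable_fun setT (\1_pinned : Omega -> R).
  exact/measurable_indic/measurable_pinned.
have pinned1 w : `|\1_pinned w : R| <= 1.
  by rewrite indicE normr_nat lern1 leq_b1.
have PE : fine (P pinned) = \int[P]_w starts X w * \prod_i (expR (- a i) * coshR (a i)).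
  rewrite -(Rintegral_indic P measurable_pinned).
  transitivity (\int[P]_w (starts X w * returns X w * walk_sign X [::] w)).
    by apply: eq_Rintegral => w _; rewrite startsE /walk_sign big_nil mulr1.
  rewrite (bridge_sign_moment walk)//; congr (_ * _); apply: eq_bigr => i _.
  by rewrite sign_integral_nil// mulr1.
have moment tau : {in tau, forall p, 0 <= p.2 <= 1} ->
    \int[P]_w (\1_pinned w * walk_sign X tau w) = fine (P pinned) *
    \prod_i (coshR (a i * sign_integral (times i tau) 1) / coshR (a i)).
  move=> tau01.
  transitivity (\int[P]_w (starts X w * returns X w * walk_sign X tau w)).
    by apply: eq_Rintegral => w _; rewrite startsE.
  rewrite (bridge_sign_moment walk)// PE -mulrA -big_split; congr (_ * _).
  apply: eq_bigr => i _ /=; field; exact: lt0r_neq0 (coshR_gt0 _).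
have integrable_moment tau : {in tau, forall p, 0 <= p.2 <= 1} ->
    P.-integrable setT (EFin \o (fun w => \1_pinned w * walk_sign X tau w)).
  move=> tau01; apply: (@bounded_integrable _ _ _ _ _ 1).
    apply: measurable_funM => //; apply: measurable_prod => p /tau01 p01.
    by apply: measurable_sign; exact: (measurable_walk_pred walk (fun x => x p.1)).
  by move=> w; rewrite normrM; apply: mulr_ile1 => //; exact: normr_prod_sign.
rewrite -(Rintegral_indic P (measurableI _ _ measurable_pinned (measurable_walk_cylinder s01))).
transitivity (\int[P]_w \sum_(z <- expansion sigma)
    z.1 * (\1_pinned w * walk_sign X z.2 w)).
  apply: eq_Rintegral => w _; rewrite indicI /= [\1_(walk_cylinder sigma) w]indicE.
  have -> : (w \in walk_cylinder sigma) = all (fun q => X q.1.2 w q.1.1 == q.2) sigma.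
    by apply/idP/idP; rewrite inE.
  rewrite (expansionE (fun p => X p.2 w p.1)) mulr_sumr.
  by apply: eq_bigr => z _; rewrite mulrCA.
have iz : {in expansion sigma, forall z, P.-integrable setT
    (EFin \o (fun w => z.1 * (\1_pinned w * walk_sign X z.2 w)))}.
  move=> z zs; have := integrableZl measurableT z.1 (integrable_moment _ (z01 z zs)).
  by apply.
rewrite (integrable_sum_seq iz).2 mulr_sumr; apply: eq_big_seq => z zs.
rewrite RintegralZl//; last exact: integrable_moment (z01 z zs).
rewrite (moment _ (z01 z zs)); exact: mulrCA.
Qed.

End bridge_identification.

Section bridge_laws.
Context (R : realType) (d : nat).
Local Notation TT := (d.-tuple (even_fset R)).

Definition bridge (a : 'I_d -> R) : probability TT R := bridge_product a (enum 'I_d).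

Lemma bridge_cylinder (a : 'I_d -> R) (sigma : seq ('I_d * R * bool)) : {in sigma, forall q, 0 <= q.1.2 <= 1} ->
  fine (bridge a (cylinder sigma)) = \sum_(z <- expansion sigma) z.1 *
    \prod_i (coshR (a i * sign_integral (times i z.2) 1) / coshR (a i)).
Proof.
move=> s01.
have z01 z : z \in expansion sigma -> {in z.2, forall p, 0 <= p.2 <= 1}.
  by move=> zs p pz; have [q qs <-] := expansion_times zs pz; exact: s01.
have ichi z : z \in expansion sigma ->
    (bridge a).-integrable setT (EFin \o tuple_chi z.2).
  move=> zs; apply: (@bounded_integrable _ _ _ _ _ 1) => [|U].
    exact: measurable_tuple_chi (z01 z zs).
  exact: normr_prod_sign.
rewrite -(Rintegral_indic (bridge a) (measurable_cylinder s01)).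
transitivity (\int[bridge a]_U \sum_(z <- expansion sigma) z.1 * tuple_chi z.2 U).
  apply: eq_Rintegral => U _; rewrite indicE.
  have -> : (U \in cylinder sigma) = all (fun q => path_of (tnth U q.1.1) q.1.2 == q.2) sigma.
    by apply/idP/idP; rewrite inE.
  exact: (expansionE (fun p => path_of (tnth U p.1) p.2)).
have iz : {in expansion sigma, forall z, (bridge a).-integrable setT
    (EFin \o (fun U => z.1 * tuple_chi z.2 U))}.
  by move=> z zs; have := integrableZl measurableT z.1 (ichi z zs); apply.
rewrite (integrable_sum_seq iz).2; apply: eq_big_seq => z zs.
rewrite RintegralZl//; last exact: ichi.
rewrite bridge_product_chi ?enum_uniq//; last exact: z01.
  rewrite big_enum; congr (_ * _); apply: eq_bigr => i _.
  by rewrite unif_eps.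
by move=> p _; rewrite mem_enum.
Qed.

(** Since [mu] has total mass 1, almost every pinned path is encoded by a tuple, and
    the probability of a cylinder under [mu] is that of the corresponding event of
    the chain given that the path is pinned. *)
Lemma bridge_law_unique (a : 'I_d -> R) (mu : probability TT R) :
  bridge_law a mu -> forall A, measurable A -> mu A = bridge a A.
Proof.
case=> disp [T] [P] [X] [walk P0 muE].
apply: cylinders_determine => sigma s01.
have fE : 0 < fine (P (pinned X)).
  by rewrite fine_gt0// P0 (le_lt_trans (probability_le1 _ _)) ?ltry//; exact: measurable_pinned walk.
have mEB := measurable_pinned_encoded walk.
have mE := measurable_pinned walk.
have mC := measurable_walk_cylinder walk s01.
have PEB : P (pinned X `&` encoded_in X setT) = P (pinned X).
  have := muE setT measurableT; rewrite probability_setT /= => -[].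
  move/(congr1 (fun r => r * fine (P (pinned X)))).
  rewrite mul1r divfK ?gt_eqF// => E.
  by rewrite -[LHS]fineK ?fin_num_measure// -[RHS]fineK ?fin_num_measure// E.
have PEC : P (pinned X `&` encoded_in X setT `&` walk_cylinder X sigma) =
    P (pinned X `&` walk_cylinder X sigma).
  set EB := pinned X `&` encoded_in X setT; rewrite -/EB in PEB mEB.
  have mD : measurable (pinned X `\` EB) by exact: measurableD.
  have null : P (pinned X `\` EB) = 0.
    rewrite measureD// ?(le_lt_trans (probability_le1 _ _)) ?ltry//.
    have -> : pinned X `&` EB = EB by apply/setIidPr => w [].
    rewrite -[RHS](subee (x := P (pinned X))) ?fin_num_measure//.
    by apply: (congr1 (fun e => P (pinned X) - e)%E); exact: PEB.
  apply/eqP; rewrite eq_le; apply/andP; split.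
    apply: le_measure; rewrite ?inE; [exact: measurableI|exact: measurableI|].
    by move=> w [[]].
  rewrite -[leRHS]adde0 -null; apply: le_trans (measureU2 _ _ _) => //.
    apply: le_measure; rewrite ?inE; [exact: measurableI| |].
      by apply: measurableU => //; exact: measurableI.
    move=> w [Ew Cw]; have [EBw|EBw] := pselect (EB w); first by left.
    by right.
  exact: measurableI.
rewrite (muE _ (measurable_cylinder s01)) -[RHS]fineK ?fin_num_measure//; last first.
  exact: measurable_cylinder.
rewrite bridge_cylinder//; congr EFin.
rewrite -[X in fine (P X)]/(pinned X `&` encoded_in X (cylinder sigma)).
rewrite (pinned_encoded_cylinder walk)// PEC (pinned_cylinder_prob walk)//.
by rewrite mulrAC divff ?mul1r// gt_eqF.
Qed.

End bridge_laws.

(** * The Wasserstein bound *)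

Unset Implicit Arguments.

Theorem corollary3p8 (R : realType) (d : nat) (hd : (2 <= d)%N)
    (alpha beta : 'I_d -> R)
    (halpha : forall i, 0 <= alpha i) (hbeta : forall i, 0 <= beta i)
    (P0 Q0 : probability (d.-tuple (even_fset R)) R)
    (hP : bridge_law alpha P0) (hQ : bridge_law beta Q0) :
  (wasserstein1 P0 Q0 <=
    (9 / 2 * \sum_(i < d) `|alpha i ^+ 2 - beta i ^+ 2|)%:E)%E.
Proof.
apply: ge_ereal_sup => _ [f [mf iP iQ lf] <-].
have lf' := lipschitz1_toggle lf.
have integralE a (mu : probability (d.-tuple (even_fset R)) R) : bridge_law a mu ->
    (\int[mu]_U (f U)%:E = (\int[bridge a]_U f U)%:E)%E.
  move=> hmu; transitivity (\int[bridge a]_U (f U)%:E)%E.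
    apply: eq_measure_integral => A mA _; exact: bridge_law_unique hmu A mA.
  rewrite fineK//; apply: integrable_fin_num => //.
  exact: uncenter_integrable (bridge_product_lipschitz a (enum 'I_d) mf lf').1.
rewrite (integralE _ _ hP) (integralE _ _ hQ) -EFinB lee_fin.
apply: (le_trans (bridge_product_wasserstein (enum 'I_d) halpha hbeta mf lf')).
rewrite big_enum mulr_sumr; apply: ler_sum => i _.
by rewrite ler_wpM2r//; lra.
Qed.
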